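(* (Closing Lemma.) Let $X$ be a compact complex manifold of dimension $k$, $f:X\dashrightarrow X$ a dominant meromorphic map with indeterminacy set $I$, and $\mu$ an $f$-invariant ergodic probability measure with $\int\log d(x,I)\,d\mu(x)>-\infty$ whose Lyapunov exponents (with multiplicity) satisfy $\chi_1\ge\cdots\ge\chi_{m_0}>0>\chi_{m_0+1}\ge\cdots\ge\chi_k$ for some $1\le m_0\le k-1$. Let $\gamma>0$ be sufficiently small, depending only on the exponents, with in particular $4\gamma<\chi_{m_0}-\chi_{m_0+1}$; let $0<\delta<\frac16$, and let $\Lambda_\delta\subset\widehat\Omega$ be a compact set as described in the context (a Lusin set of $\widehat\mu$-measure at least $1-\delta$ for the Pesin charts associated with $\gamma$). Then for every $\epsilon>0$ there exists $\eta>0$ such that: if $\widehat x\in\Lambda_\delta$ and $\widehat f^m(\widehat x)\in\Lambda_\delta$ for some integer $m\ge1$, with $\mathrm{dist}(\widehat x,\widehat f^m(\widehat x))<\eta$, then there exists $z\in X$ such that, with $x=\pi(\widehat x)$: 1. $f^m(z)=z$; 2. $\mathrm{dist}(f^i(x),f^i(z))\le\epsilon\,\max(e^{-\gamma i},e^{-\gamma(m-i)})$ for $0\le i\le m$; 3. $z$ is hyperbolic.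
   Context: **Natural extension.** $\Omega=X\setminus\bigcup_{i\ge0}f^{-i}(I)$ has full $\mu$-measure. $\widehat\Omega=\{\widehat x=(x_n)_{n\in\mathbb{Z}}\in\Omega^{\mathbb{Z}}: f(x_n)=x_{n+1}\}$, $\widehat f$ is the left shift, $\pi(\widehat x)=x_0$ (also denoted $x$), and $\widehat\mu$ is the unique $\widehat f$-invariant probability with $\pi_*\widehat\mu=\mu$. $\widehat\Omega$ carries a fixed standard metric (inducing the product topology) with $\mathrm{dist}(\widehat x,\widehat y)\ge\mathrm{dist}(\pi(\widehat x),\pi(\widehat y))$. **Charts.** $X$ is covered by finitely many charts $(U_i,\psi_i)$ (with $\psi_i$ a parametrization from an open set of $\mathbb{C}^k$ to $X$) whose boundaries have zero $\mu$-measure. For each $x\in X$, $\tau_x=\psi_i\circ t_x$ for some $i$ and a translation $t_x$ of $\mathbb{C}^k$, with $\tau_x(0)=x$; $\tau_x$ is defined on a ball $B(0,R_* )$ with $R_*$ independent of $x$, and its first and second derivatives are bounded there uniformly in $x$. For $x\notin I$, $f_x=\tau_{f(x)}^{-1}\circ f\circ\tau_x$ near $0$; $A(\widehat x)=Df_x(0)$. **Oseledets–Pesin reduction.** Let $\lambda_1>\dots>\lambda_l\ge-\infty$ be the distinct Lyapunov exponents of the cocycle $A$ over $(\widehat f,\widehat\mu)$, with multiplicities $m_1,\dots,m_l$ (the $\chi_j$ are the $\lambda_i$ repeated $m_i$ times). On a set $\widehat\Gamma$ of full $\widehat\mu$-measure there is a splitting $\mathbb{C}^k=\bigoplus_iE_i(\widehat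 x)$, $\dim E_i=m_i$, with $A(\widehat x)E_i(\widehat x)\subset E_i(\widehat f(\widehat x))$ (equality if $\lambda_i>-\infty$) and $\frac1n\log\|A(\widehat f^{n-1}(\widehat x))\cdots A(\widehat x)v\|\to\lambda_i$ for $0\ne v\in E_i(\widehat x)$ (also as $n\to-\infty$ if $\lambda_i>-\infty$). For $\gamma>0$ there is a measurable $C_\gamma:\widehat\Gamma\to GL_k(\mathbb{C})$ with $\lim_{n\to\pm\infty}\frac1n\log\|C_\gamma^{\pm1}(\widehat f^n(\widehat x))\|=0$, sending the standard splitting $\bigoplus\mathbb{C}^{m_i}$ to $\bigoplus E_i(\widehat x)$, such that $A_\gamma(\widehat x)=C_\gamma^{-1}(\widehat f(\widehat x))A(\widehat x)C_\gamma(\widehat x)$ is block diagonal with blocks $A^i_\gamma(\widehat x)$ satisfying $e^{\lambda_i-\gamma}\|v\|\le\|A^i_\gamma(\widehat x)v\|\le e^{\lambda_i+\gamma}\|v\|$ if $\lambda_i>-\infty$, and $\|A^l_\gamma(\widehat x)v\|\le e^{-4\gamma}\|v\|$ if $\lambda_l=-\infty$. **The function $r$.** Put $g_{\widehat x}=C_\gamma^{-1}(\widehat f(\widehat x))\circ f_x\circ C_\gamma(\widehat x)$. There are constants $\epsilon_1,C,p>0$ (depending on $X,f$ and the charts) such that for $\|w\|\le\epsilon_1d(x,I)^p/\|C_\gamma(\widehat x)\|$ the map $g_{\widehat x}$ is holomorphic and $\|D^2g_{\widehat x}(w)\|\le2C\|C_\gamma^{-1}(\widehat f(\widehat x))\|\,\|C_\gamma(\widehat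 x)\|^2d(x,I)^{-p}$. Let $\alpha(\widehat x)=\max\big(1,\ \|C_\gamma(\widehat x)\|/(\epsilon_1d(x,I)^p),\ 2C\|C_\gamma^{-1}(\widehat f(\widehat x))\|\|C_\gamma(\widehat x)\|^2d(x,I)^{-p}\big)$. This is tempered on an invariant full-measure set $\widehat\Gamma'\subset\widehat\Gamma$, so there is a measurable $\alpha_\gamma\ge\alpha$ with $e^{-\gamma}\le\alpha_\gamma(\widehat f(\widehat x))/\alpha_\gamma(\widehat x)\le e^\gamma$ on $\widehat\Gamma'$; one sets $r(\widehat x)=1/\alpha_\gamma(\widehat x)\in(0,1]$. In particular $g_{\widehat x}$ is holomorphic with $\|D^2g_{\widehat x}\|\le1/r(\widehat x)$ on $\|w\|\le r(\widehat x)$. **The set $\Lambda_\delta$.** Choose $\epsilon_0>0$ so small that the $\epsilon_0$-neighbourhood $V_{\epsilon_0}$ of the boundaries of the charts has $\mu(V_{\epsilon_0})\le\delta/2$. The family $(\tau_x)$ is chosen so that if $x,y\notin V_{\epsilon_0}$ and $\mathrm{dist}(x,y)<\epsilon_0$ then $\tau_x,\tau_y$ use the same $\psi_i$ (so $\tau_x^{-1}\circ\tau_y$ is a translation). $\Lambda_\delta\subset\widehat\Gamma'\cap\pi^{-1}(X\setminus V_{\epsilon_0})$ is compact, $\widehat\mu(\Lambda_\delta)\ge1-\delta$, and $C_\gamma^{\pm1}$ and $r$ are continuous on $\Lambda_\delta$. **Hyperbolic** for a periodic point $f^m(z)=z$ (with $f^i(z)\notin I$ for $0\le i<m$) means that $Df^m(z)$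 has no eigenvalue of modulus $1$. *)

(* Defs.v *)
From HB Require Import structures.
From mathcomp Require Import all_boot all_order all_algebra.
From mathcomp Require Import complex.
From mathcomp Require Import all_classical all_reals all_analysis.
Set Implicit Arguments. Unset Strict Implicit. Unset Printing Implicit Defensive.
Import Order.TTheory GRing.Theory Num.Theory.
Import numFieldNormedType.Exports.
Local Open Scope classical_set_scope.
Local Open Scope ring_scope.
Local Open Scope complex_scope.

(* [complex R] has no topology of its own in the library: give it the one of
   the norm, so that matrices over R[i] are normed modules over R[i]. *)
HB.instance Definition _ (R : realType) := PseudoPointedMetric.copy R[i] R[i]^o.
HB.instance Definition _ (R : realType) := NormedModule.copy R[i] R[i]^o.

#[short(type="pmetricType")]
HB.structure Definition PointedMetric (K : numDomainType) :=
  { M of Metric K M & isPointed M }.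

Notation borel T := (g_sigma_algebraType (@open T)).

Section LinearAlgebra.
Context {R : realType} {k : nat}.
Local Notation Ck := 'cV[R[i]]_k.

(* The library norm on column vectors is the max norm with values in R[i];
   the norm of C^k used here is the Hermitian one, with values in R. *)
Definition enorm (v : Ck) : R :=
  Num.sqrt (\sum_(j < k) (Normc.normc (v j 0)) ^+ 2).

Definition opnorm (A : 'M[R[i]]_k) : R :=
  sup [set enorm (A *m v) | v in [set v : Ck | enorm v <= 1]].

(* Columns are the images of the canonical basis: 'd g w v = jac g w *m v.
   Since the scalars are R[i], [differentiable] is complex differentiability. *)
Definition jac (g : Ck -> Ck) (w : Ck) : 'M[R[i]]_k :=
  \matrix_(i < k, j < k) ('d g w (delta_mx j 0 : Ck)) i 0.

Definition norm_D_le (g : Ck -> Ck) (w : Ck) (B : R) : Prop :=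
  differentiable g w /\ forall v : Ck, enorm ('d g w v) <= B * enorm v.

(* The first conjunct is automatic for holomorphic g. *)
Definition norm_D2_le (g : Ck -> Ck) (w : Ck) (B : R) : Prop :=
  (forall v : Ck, differentiable ('D_v g : Ck -> Ck) w) /\
  forall u v : Ck, enorm ('D_u ('D_v g) w) <= B * enorm u * enorm v.

End LinearAlgebra.

Section Manifold.
Context {R : realType} {k : nat} {X : pmetricType R}.
Local Notation Ck := 'cV[R[i]]_k.

(* A chart is given by a parametrization [par] on [cdom], with inverse
   [coord] on the image; both maps are arbitrary elsewhere. *)
Record chart := Chart {
  cdom : set Ck;
  par : Ck -> X;
  coord : X -> Ck }.

Definition cimg (c : chart) : set X := par c @` cdom c.

Definition is_chart (c : chart) : Prop :=
  [/\ open (cdom c), open (cimg c),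
      forall u, cdom c u -> coord c (par c u) = u,
      forall u, cdom c u -> {for u, continuous (par c)} &
      forall x, cimg c x -> {for x, continuous (coord c)}].

Definition compatible (c d : chart) : Prop :=
  forall u, cdom c u -> cimg d (par c u) ->
    differentiable (coord d \o par c) u.

Definition locally_bilipschitz (c : chart) : Prop :=
  forall u, cdom c u -> exists L rho : R, [/\ 0 < L, 0 < rho &
    forall v w, enorm (v - u) < rho -> enorm (w - u) < rho ->
      mdist (par c v) (par c w) <= L * enorm (v - w) /\
      enorm (v - w) <= L * mdist (par c v) (par c w)].

(* The last field is all that is retained of the distance being induced by a
   Hermitian (or any Riemannian) metric: it is comparable with the Euclidean
   distance in charts. *)
Record complex_manifold := ComplexManifold {
  atlas : set chart;
  atlas_chart : forall c, atlas c -> is_chart c;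
  atlas_cover : forall x, exists2 c, atlas c & cimg c x;
  atlas_compatible : forall c d, atlas c -> atlas d -> compatible c d;
  atlas_dist : forall c, atlas c -> locally_bilipschitz c }.

Variable M : complex_manifold.

Definition holomorphic_chart (c : chart) : Prop :=
  is_chart c /\
  forall d, atlas M d -> compatible c d /\ compatible d c.

Definition holomorphic_on (U : set X) (f : X -> X) : Prop :=
  open U /\
  forall x, U x -> {for x, continuous f} /\
    forall c d u, atlas M c -> atlas M d -> cdom c u -> par c u = x ->
      cimg d (f x) -> differentiable (coord d \o f \o par c) u.

Definition analytic_near (V : normedModType R[i]) (Z : set V) (u : V) : Prop :=
  exists (N : set V) (n : nat) (h : 'I_n -> V -> R[i]),
    [/\ open N, N u,
        forall i v, N v -> differentiable (h i) v &
        forall v, N v -> (Z v <-> forall i, h i v = 0)].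

Definition analytic_subset (Z : set X) : Prop :=
  forall c u, atlas M c -> cdom c u -> analytic_near (par c @^-1` Z) u.

Definition analytic_subset_square (Z : set (X * X)) : Prop :=
  forall c d u v, atlas M c -> atlas M d -> cdom c u -> cdom d v ->
    analytic_near [set p : Ck * Ck | Z (par c p.1, par d p.2)] (u, v).

(* A meromorphic map is a total function whose values on the indeterminacy
   set [I] are irrelevant. *)
Record meromorphic (f : X -> X) (I : set X) : Prop := {
  mero_analytic : analytic_subset I;
  mero_dense : dense (~` I);
  mero_holo : holomorphic_on (~` I) f;
  mero_graph :
    analytic_subset_square (closure [set (x, f x) | x in ~` I]);
  mero_indet : forall x, I x -> ~ exists (U : set X) (g : X -> X),
    [/\ U x, holomorphic_on U g & forall y, U y -> ~ I y -> g y = f y] }.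

Definition dominant (f : X -> X) (I : set X) : Prop := dense (f @` (~` I)).

Definition boundary (U : set X) : set X := closure U `\` interior U.

Definition periodic_point (f : X -> X) (I : set X) (m : nat) (z : X) : Prop :=
  (forall i, (i < m)%N -> ~ I (iter i f z)) /\ iter m f z = z.

(* Df^m(z) is read in charts at z; its spectrum does not depend on the chart. *)
Definition hyperbolic_point (f : X -> X) (m : nat) (z : X) : Prop :=
  forall c u, atlas M c -> cdom c u -> par c u = z ->
    forall a : R[i],
      eigenvalue (jac (coord c \o iter m f \o par c) u) a -> `|a| != 1.

End Manifold.
Arguments chart {R} k X.
Arguments complex_manifold {R} k X.

Section InvariantMeasure.
Context {R : realType} {X : pmetricType R}.
Variables (f : X -> X) (I : set X).

(* d(x, set0) = 1: for empty I any positive constant would do. *)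
Definition dist_to (x : X) : R :=
  if `[< I !=set0 >] then inf [set mdist x y | y in I] else 1.

Record invariant_ergodic (mu : probability (borel X) R) : Prop := {
  (* [lne 0 = -oo], so this contains mu I = 0 *)
  log_dist_integrable :
    (-oo < \int[mu]_(x in [set: X]) lne (dist_to x)%:E)%E;
  mu_invariant : forall B : set (borel X), measurable B ->
    mu (~` I `&` f @^-1` B) = mu B;
  mu_ergodic : forall B : set (borel X), measurable B ->
    ~` I `&` f @^-1` B = ~` I `&` B -> mu B = 0%E \/ mu B = 1%E }.

Definition Omega : set X := [set x | forall n, ~ I (iter n f x)].

Local Notation hatX := {ptws int -> X}.

Definition Omega_hat : set hatX :=
  [set x | forall n : int, Omega (x n) /\ f (x n) = x (n + 1)].

(* [shiftZ n] is the n-th iterate of the left shift; the projection pi is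
   evaluation at 0. *)
Definition shiftZ (n : int) (x : hatX) : hatX := fun j : int => x (j + n).

Record natural_extension (mu : probability (borel X) R)
    (muhat : probability (borel hatX) R) : Prop := {
  muhat_support : muhat Omega_hat = 1%E;
  muhat_invariant : forall B : set (borel hatX), measurable B ->
    muhat (shiftZ 1 @^-1` B) = muhat B;
  muhat_proj : forall B : set (borel X), measurable B ->
    muhat [set x : hatX | B (x 0)] = mu B }.

Record standard_metric (dhat : hatX -> hatX -> R) : Prop := {
  dhat_ge0 : forall x y, Omega_hat x -> Omega_hat y -> 0 <= dhat x y;
  dhat_eq0 : forall x y, Omega_hat x -> Omega_hat y ->
    (dhat x y = 0 <-> x = y);
  dhat_sym : forall x y, Omega_hat x -> Omega_hat y -> dhat x y = dhat y x;
  dhat_triangle : forall x y z, Omega_hat x -> Omega_hat y -> Omega_hat z ->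
    dhat x z <= dhat x y + dhat y z;
  dhat_topology : forall (x : hatX) (U : set hatX), Omega_hat x ->
    (within Omega_hat (nbhs x) U <->
     exists2 e : R, 0 < e & forall y, Omega_hat y -> dhat x y < e -> U y);
  dhat_proj : forall x y, Omega_hat x -> Omega_hat y ->
    mdist (x 0) (y 0) <= dhat x y }.

Definition invariant_full_set (muhat : probability (borel hatX) R)
    (G : set hatX) : Prop :=
  [/\ measurable (G : set (borel hatX)), muhat G = 1%E, G `<=` Omega_hat &
      forall x, G (shiftZ 1 x) <-> G x].

(* (1/n) log (a (shiftZ n x)) tends to 0 as n tends to both infinities *)
Definition tempered (a : hatX -> R) (x : hatX) : Prop :=
  ((n%:R^-1 * ln (a (shiftZ n%:Z x))) @[n --> \oo] --> (0 : R)) /\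
  ((n%:R^-1 * ln (a (shiftZ (- n%:Z) x))) @[n --> \oo] --> (0 : R)).

End InvariantMeasure.

Section Charts.
Context {R : realType} {k : nat} {X : pmetricType R}.
Local Notation Ck := 'cV[R[i]]_k.
Local Notation hatX := {ptws int -> X}.

(* tau_x is the chart number [tidx x] precomposed with w |-> tbase x + w *)
Record chart_family := ChartFamily {
  nb_charts : nat;
  psi : 'I_nb_charts -> chart k X;
  tidx : X -> 'I_nb_charts;
  tbase : X -> Ck;
  tradius : R }.

Variables (M : complex_manifold k X) (f : X -> X) (I : set X).
Variable T : chart_family.

Definition tau (x : X) (w : Ck) : X := par (psi (tidx T x)) (tbase T x + w).

Definition tau_inv (x y : X) : Ck := coord (psi (tidx T x)) y - tbase T x.

Record good_charts (mu : probability (borel X) R) : Prop := {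
  psi_holomorphic : forall i, holomorphic_chart M (@psi T i);
  psi_cover : forall x, exists i, cimg (@psi T i) x;
  psi_boundary : forall i, mu (boundary (cimg (@psi T i))) = 0%E;
  tau_center : forall x, tau x 0 = x;
  tau_radius : 0 < tradius T;
  tau_domain : forall x w, enorm w < tradius T ->
    cdom (psi (tidx T x)) (tbase T x + w);
  (* first and second derivatives of tau_x bounded uniformly in x, the target
     X being read near each of its points in a fixed chart *)
  tau_bounded : forall c p, atlas M c -> cimg c p ->
    exists (W : set X) (B : R), nbhs p W /\
      forall x w, enorm w < tradius T -> W (tau x w) ->
        norm_D_le (coord c \o tau x) w B /\
        norm_D2_le (coord c \o tau x) w B }.

Definition floc (x : X) : Ck -> Ck := tau_inv (f x) \o f \o tau x.

(* domain of [floc x], the maps tau being restricted to the ball of radius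
   [tradius T] *)
Definition floc_dom (x : X) : set Ck :=
  [set w | [/\ enorm w < tradius T, ~ I (tau x w) &
     exists2 v, enorm v < tradius T & f (tau x w) = tau (f x) v]].

Definition cocycle (x : hatX) : 'M[R[i]]_k := jac (floc (x 0)) 0.

Fixpoint cocycle_iter (n : nat) (x : hatX) : 'M[R[i]]_k :=
  if n is n'.+1 then cocycle (shiftZ n'%:Z x) *m cocycle_iter n' x
  else 1%:M.

Definition near_boundary (e : R) : set X :=
  [set x | exists i y, boundary (cimg (@psi T i)) y /\ mdist x y < e].

End Charts.
Arguments chart_family {R} k X.

Section Pesin.
Context {R : realType} {k : nat} {X : pmetricType R}.
Local Notation Ck := 'cV[R[i]]_k.
Local Notation hatX := {ptws int -> X}.

(* the values of chi are the lambda i, each taken mult i times *)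
Record exponents_with_multiplicity (chi : 'I_k -> \bar R) (l : nat)
    (lambda : 'I_l -> \bar R) (mult : 'I_l -> nat) : Prop := {
  lambda_dec : forall i j : 'I_l, (i < j)%N -> (lambda j < lambda i)%E;
  mult_gt0 : forall i, (0 < mult i)%N;
  chi_mult : forall i, #|[set a | chi a == lambda i]%SET| = mult i;
  chi_lambda : forall a, exists i, chi a = lambda i }.

Variables (f : X -> X) (I : set X) (T : chart_family k X).
Variables (muhat : probability (borel hatX) R).
Variables (chi : 'I_k -> \bar R) (l : nat) (lambda : 'I_l -> \bar R).
Variable mult : 'I_l -> nat.

Local Notation A := (cocycle f T).
Local Notation fhat := (shiftZ 1).

Record oseledets (G : set hatX) (E : 'I_l -> hatX -> {vspace Ck}) : Prop := {
  os_set : invariant_full_set f I muhat G;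
  os_split : forall x, G x ->
    (\sum_(i < l) E i x)%VS = fullv /\ directv (\sum_(i < l) E i x);
  os_dim : forall x i, G x -> \dim (E i x) = mult i;
  os_sub : forall x i v, G x -> v \in E i x -> A x *m v \in E i (fhat x);
  os_onto : forall x i v, G x -> lambda i != -oo%E -> v \in E i (fhat x) ->
    exists2 u, u \in E i x & A x *m u = v;
  os_forward : forall x i v, G x -> v \in E i x -> v != 0 ->
    ((n%:R^-1)%:E * lne (enorm (cocycle_iter f T n x *m v))%:E)%E
      @[n --> \oo] --> lambda i;
  (* [u n] plays the role of the n-th backward iterate of v *)
  os_backward : forall x i (u : nat -> Ck), G x -> lambda i != -oo%E ->
    u 0%N != 0 ->
    (forall n, u n \in E i (shiftZ (- n%:Z) x)) ->
    (forall n, A (shiftZ (- n.+1%:Z) x) *m u n.+1 = u n) ->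
    ((- n%:R^-1)%:E * lne (enorm (u n))%:E)%E @[n --> \oo] --> lambda i }.

(* the i-th summand of the standard splitting of C^k *)
Definition in_block (i : 'I_l) (v : Ck) : Prop :=
  forall a, chi a != lambda i -> v a 0 = 0.

Variables (gamma : R) (C : hatX -> 'M[R[i]]_k).

Definition Cinv (x : hatX) : 'M[R[i]]_k := invmx (C x).

Definition Agamma (x : hatX) : 'M[R[i]]_k := Cinv (fhat x) *m A x *m C x.

Record pesin_reduction (G : set hatX) (E : 'I_l -> hatX -> {vspace Ck})
    : Prop := {
  pe_unit : forall x, G x -> C x \in unitmx;
  pe_measurable : forall a b,
    measurable_fun (G : set (borel hatX))
      (fun x : borel hatX => complex.Re (C x a b)) /\
    measurable_fun (G : set (borel hatX))
      (fun x : borel hatX => complex.Im (C x a b));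
  pe_tempered : forall x, G x ->
    tempered (fun y => opnorm (C y)) x /\
    tempered (fun y => opnorm (Cinv y)) x;
  pe_split : forall x i w, G x ->
    (w \in E i x <-> exists2 v, in_block i v & w = C x *m v);
  pe_diag : forall x a b, G x -> chi a != chi b -> Agamma x a b = 0;
  pe_finite : forall x i v, G x -> lambda i != -oo%E -> in_block i v ->
    expR (fine (lambda i) - gamma) * enorm v <= enorm (Agamma x *m v)
      <= expR (fine (lambda i) + gamma) * enorm v;
  pe_infinite : forall x i v, G x -> lambda i = -oo%E -> in_block i v ->
    enorm (Agamma x *m v) <= expR (- (4 * gamma)) * enorm v }.

Definition gloc (x : hatX) (w : Ck) : Ck :=
  Cinv (fhat x) *m floc f T (x 0) (C x *m w).

Variables (eps1 K p : R).

Local Notation d x := (dist_to I (x 0)).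

Definition D2_bound (x : hatX) : R :=
  2 * K * opnorm (Cinv (fhat x)) * opnorm (C x) ^+ 2 * d x `^ (- p).

Definition holomorphy_constants (G : set hatX) : Prop :=
  [/\ 0 < eps1, 0 < K, 0 < p &
    forall x w, G x -> enorm w <= eps1 * d x `^ p / opnorm (C x) ->
      [/\ floc_dom f I T (x 0) (C x *m w),
          differentiable (gloc x) w &
          norm_D2_le (gloc x) w (D2_bound x)]].

Definition alpha (x : hatX) : R :=
  Num.max 1 (Num.max (opnorm (C x) / (eps1 * d x `^ p)) (D2_bound x)).

Record tempered_majorant (G G' : set hatX) (alphag : hatX -> R) : Prop := {
  tm_set : invariant_full_set f I muhat G';
  tm_sub : G' `<=` G;
  tm_tempered : forall x, G' x -> tempered alpha x;
  tm_measurable : measurable_fun (G' : set (borel hatX))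
    (alphag : borel hatX -> R);
  tm_ge : forall x, G' x -> alpha x <= alphag x;
  tm_ratio : forall x, G' x ->
    expR (- gamma) <= alphag (fhat x) / alphag x <= expR gamma }.

Record lusin_set (mu : probability (borel X) R) (G' : set hatX)
    (alphag : hatX -> R) (delta eps0 : R) (L : set hatX) : Prop := {
  lu_eps0 : 0 < eps0;
  lu_boundary : (mu (near_boundary T eps0) <= (delta / 2)%:E)%E;
  lu_same_chart : forall x y, ~ near_boundary T eps0 x ->
    ~ near_boundary T eps0 y -> mdist x y < eps0 -> tidx T x = tidx T y;
  lu_sub : forall x, L x -> G' x /\ ~ near_boundary T eps0 (x 0);
  lu_compact : compact L;
  lu_measure : ((1 - delta)%:E <= muhat L)%E;
  lu_C : {within L, continuous C};
  lu_Cinv : {within L, continuous Cinv};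
  lu_r : {within L, continuous (fun x => (alphag x)^-1 : R)} }.

End Pesin.

(* Main.v *)
Require Import Defs.
From HB Require Import structures.
From mathcomp Require Import all_boot all_order all_algebra.
From mathcomp Require Import complex.
From mathcomp Require Import all_classical all_reals all_analysis.
From mathcomp Require Import ring lra.
Set Implicit Arguments. Unset Strict Implicit. Unset Printing Implicit Defensive.
Import Order.TTheory GRing.Theory Num.Theory.
Import numFieldNormedType.Exports.
Local Open Scope classical_set_scope.
Local Open Scope ring_scope.
Local Open Scope complex_scope.

(** Read in Pesin charts along the orbit of [x], [f] becomes a sequence of maps
    [g_n = A_n + small Lipschitz], where [A_n] is block diagonal, contracts the
    stable block by [exp (-4 gamma)] and expands the unstable block by
    [exp (4 gamma)].  Since [x] and its [m]-th image lie close together in the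
    compact set, their Pesin charts almost coincide, and composing the last
    [g_n] with the change of chart closes the sequence into a cycle without
    spoiling these estimates.  The operator on [m]-periodic sequences which
    pushes stable components forward and pulls unstable components back is a
    contraction for the weights
    [max (exp (-2 gamma n), exp (-2 gamma (m - n)))]; its fixed point is the
    orbit of [z].  The charts are distorted by a factor at most
    [const * exp (gamma * min (n, m - n))], and multiplying the weights by it
    leaves the rate [max (exp (-gamma n), exp (-gamma (m - n)))].  An eigenvector
    of [Df^m(z)] for an eigenvalue of modulus one would give a nonzero cyclic
    orbit, up to a phase, of the linearized sequence, which the same estimates
    exclude. *)

(** * Hermitian norm *)

(** The cycle can be closed exactly because the Lusin set avoids the chart boundaries: [x] and its
    return use the same [psi], so the change of Pesin chart is the affine map [return_map]. Its
    linear part is within [c0 * kappa] of the identity and its constant part is at most [c0 * beta].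
    The first enters the Lipschitz constant [theta]; the second is the defect [(1 - q) * c] that a
    contraction of ratio [q] tolerates.

    The rates are tied together. [A_n] gains [sigma = exp (-4 gamma)], passing to a neighbouring
    weight costs [tau = exp (2 gamma)], and [sigma * tau < 1] leaves room for [theta]. The weights
    must also decay at least as fast as the radii [1 / a_n], which may shrink like
    [exp (-gamma * min (n, m - n))]; this two-sided control holds because both ends lie in the Lusin
    set, where [a] is at most [a0].

    An exponent [-oo] allows [A_n] to be singular, so only its unstable block is ever inverted. All
    constants are fixed before [x] and [m]. *)

Section EuclideanNorm.
Context {R : realType} {k : nat}.
Local Notation Ck := 'cV[R[i]]_k.
Implicit Types (u v w : Ck) (a : R[i]).
Local Notation normc := Normc.normc.

Lemma normcE a : `|a| = (normc a)%:C.
Proof. by rewrite normc_def; case: a. Qed.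

Lemma normc_ge0 a : 0 <= normc a.
Proof. by case: a => x y; exact: sqrtr_ge0. Qed.

Lemma normc_real (x : R) : normc x%:C = `|x|.
Proof. by rewrite /normc /= expr0n addr0 sqrtr_sqr. Qed.

Lemma normc_le_Re_Im a : normc a <= `|complex.Re a| + `|complex.Im a|.
Proof.
case: a => x y /=; rewrite -[leRHS]ger0_norm ?addr_ge0// -sqrtr_sqr.
rewrite ler_wsqrtr// sqrrD !real_normK ?num_real// -addrA lerD2l lerDr.
by rewrite mulrn_wge0// mulr_ge0.
Qed.

Lemma Re_le_normc a : `|complex.Re a| <= normc a.
Proof. by case: a => x y /=; rewrite -sqrtr_sqr ler_wsqrtr// lerDl sqr_ge0. Qed.

Lemma Im_le_normc a : `|complex.Im a| <= normc a.
Proof. by case: a => x y /=; rewrite -sqrtr_sqr ler_wsqrtr// lerDr sqr_ge0. Qed.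

Lemma enorm_ge0 v : 0 <= enorm v.
Proof. exact: sqrtr_ge0. Qed.
#[local] Hint Resolve enorm_ge0 : core.

Lemma enorm_sqr v : enorm v ^+ 2 = \sum_(j < k) normc (v j 0) ^+ 2.
Proof. by rewrite sqr_sqrtr// sumr_ge0// => i _; exact: sqr_ge0. Qed.

Lemma enorm_le_sqr v (B : R) : 0 <= B ->
  \sum_(j < k) normc (v j 0) ^+ 2 <= B ^+ 2 -> enorm v <= B.
Proof. by move=> B0 h; rewrite -(ler_pXn2r (n := 2))// ?nnegrE// enorm_sqr. Qed.

Lemma entry_le_enorm v j : normc (v j 0) <= enorm v.
Proof.
rewrite -(ler_pXn2r (n := 2))// ?nnegrE ?normc_ge0// enorm_sqr (bigD1 j)//= lerDl.
by rewrite sumr_ge0// => i _; exact: sqr_ge0.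
Qed.

Lemma enorm0 : enorm (0 : Ck) = 0.
Proof.
rewrite /enorm big1 ?sqrtr0// => i _.
by rewrite mxE Normc.normc0 expr0n.
Qed.

Lemma enorm0_eq0 v : enorm v = 0 -> v = 0.
Proof.
move=> v0; apply/colP => j; rewrite mxE; apply: Normc.eq0_normc.
by apply/eqP; rewrite eq_le normc_ge0 andbT -v0 entry_le_enorm.
Qed.

Lemma enormZ a v : enorm (a *: v) = normc a * enorm v.
Proof.
rewrite /enorm; under eq_bigr do rewrite mxE Normc.normcM exprMn.
by rewrite -mulr_sumr sqrtrM ?sqr_ge0// sqrtr_sqr ger0_norm ?normc_ge0.
Qed.

Lemma enormZr (t : R) v : enorm (t%:C *: v) = `|t| * enorm v.
Proof. by rewrite enormZ normc_real. Qed.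

Lemma enormN v : enorm (- v) = enorm v.
Proof. by rewrite /enorm; under eq_bigr do rewrite mxE normcN. Qed.

Lemma enorm_distC u v : enorm (u - v) = enorm (v - u).
Proof. by rewrite -opprB enormN. Qed.

Lemma enormD u v : enorm (u + v) <= enorm u + enorm v.
Proof.
apply: enorm_le_sqr; first exact: addr_ge0.
have [->|u0] := eqVneq u 0.
  by rewrite enorm0 !add0r enorm_sqr.
have [->|v0] := eqVneq v 0.
  by rewrite enorm0 !addr0 enorm_sqr.
have U : 0 < enorm u by rewrite lt_def enorm_ge0 andbT; apply: contra u0 => /eqP/enorm0_eq0->.
have V : 0 < enorm v by rewrite lt_def enorm_ge0 andbT; apply: contra v0 => /eqP/enorm0_eq0->.
set A := enorm u in U *; set B := enorm v in V *.
(* Minkowski from [2xy <= (B/A) x^2 + (A/B) y^2] with [A = enorm u] and [B = enorm v], weights for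
   which the sum is exactly [(A + B)^2]. *)
apply: (@le_trans _ _ (\sum_(j < k)
  ((1 + B / A) * normc (u j 0) ^+ 2 + (1 + A / B) * normc (v j 0) ^+ 2))).
  apply: ler_sum => j _; rewrite mxE.
  set x := normc (u j 0); set y := normc (v j 0).
  apply: (@le_trans _ _ ((x + y) ^+ 2)).
    by rewrite ler_pXn2r// ?nnegrE ?addr_ge0 ?normc_ge0// le_normcD.
  rewrite -subr_ge0.
  have -> : (1 + B / A) * x ^+ 2 + (1 + A / B) * y ^+ 2 - (x + y) ^+ 2 =
    (B * x - A * y) ^+ 2 / (A * B).
    by field; rewrite !gt_eqF.
  by rewrite divr_ge0 ?sqr_ge0// mulr_ge0 ?ltW.
rewrite big_split/= -!mulr_sumr -!enorm_sqr -/A -/B.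
by rewrite le_eqVlt; apply/orP; left; apply/eqP; field; rewrite !gt_eqF.
Qed.

Lemma enormB u v : enorm (u - v) <= enorm u + enorm v.
Proof. by rewrite -(enormN v) enormD. Qed.

Lemma enorm_dist u v w : enorm (u - w) <= enorm (u - v) + enorm (v - w).
Proof. by rewrite -[u - w](subrKA v) enormD. Qed.

Lemma enorm_sum (J : finType) (F : J -> Ck) :
  enorm (\sum_j F j) <= \sum_j enorm (F j).
Proof.
elim/big_rec2: _ => [|i y x _ h]; first by rewrite enorm0.
by rewrite (le_trans (enormD _ _))// lerD2l.
Qed.

Lemma enorm_delta j : enorm (delta_mx j 0 : Ck) = 1.
Proof.
rewrite /enorm (bigD1 j)//= big1 => [|i ij]; rewrite mxE ?eqxx//=.
  by rewrite addr0 expr0n addr0 expr1n sqrtr1 expr1n sqrtr1.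
by rewrite (negbTE ij) Normc.normc0 expr0n.
Qed.

Lemma enorm_le_sum v : enorm v <= \sum_(j < k) normc (v j 0).
Proof.
rewrite {1}[v]matrix_sum_delta.
under eq_bigr do rewrite big_ord1.
apply: le_trans (enorm_sum _) _; apply: ler_sum => j _.
by rewrite enormZ enorm_delta mulr1.
Qed.

Lemma enorm_mulmx_bound (A : 'M[R[i]]_k) :
  exists2 B : R, 0 < B & forall v, enorm (A *m v) <= B * enorm v.
Proof.
exists (1 + \sum_(j < k) enorm (A *m delta_mx j 0)).
  by rewrite ltr_pwDl// sumr_ge0.
move=> v; apply: le_trans (_ : (\sum_(j < k) enorm (A *m delta_mx j 0)) * enorm v <= _); last first.
  by rewrite ler_wpM2r// lerDr.
rewrite {1}[v]matrix_sum_delta mulmx_sumr mulr_suml.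
apply: le_trans (enorm_sum _) _; apply: ler_sum => j _.
by rewrite big_ord1 -scalemxAr enormZ mulrC ler_wpM2l ?entry_le_enorm.
Qed.

(* [sup] is [0] on unbounded sets, hence the appeal to the previous lemma. *)
Lemma opnorm_has_sup (A : 'M[R[i]]_k) :
  has_sup [set enorm (A *m v) | v in [set v : Ck | enorm v <= 1]].
Proof.
split; first by exists (enorm (A *m 0)); exists 0 => //=; rewrite enorm0 ler01.
have [B B0 hB] := enorm_mulmx_bound A; exists B => _ [v /= v1 <-].
by rewrite (le_trans (hB v))// ler_piMr// ltW.
Qed.

Lemma enorm_mulmx (A : 'M[R[i]]_k) v : enorm (A *m v) <= opnorm A * enorm v.
Proof.
have [->|v0] := eqVneq v 0; first by rewrite mulmx0 enorm0 mulr0.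
have V : 0 < enorm v by rewrite lt_def enorm_ge0 andbT; apply: contra v0 => /eqP/enorm0_eq0->.
rewrite -ler_pdivrMr//.
have := @sup_upper_bound _ _ (opnorm_has_sup A).
apply; exists ((enorm v)^-1%:C *: v) => /=.
  by rewrite enormZr ger0_norm ?invr_ge0// mulVf ?gt_eqF.
by rewrite -scalemxAr enormZr ger0_norm ?invr_ge0// mulrC.
Qed.

Lemma opnorm_ge0 (A : 'M[R[i]]_k) : 0 <= opnorm A.
Proof.
have := @sup_upper_bound _ _ (opnorm_has_sup A); apply.
by exists 0; rewrite /= ?mulmx0 enorm0.
Qed.

Lemma opnorm_gt0 (A : 'M[R[i]]_k) : (0 < k)%N -> A \in unitmx -> 0 < opnorm A.
Proof.
move=> k0 uA; rewrite lt_def opnorm_ge0 andbT; apply/eqP => A0.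
have /eqP := @enorm_mulmx A (invmx A *m delta_mx (Ordinal k0) 0).
by rewrite A0 mul0r mulKVmx// enorm_delta real_leNgt ?num_real// ltr01.
Qed.

Lemma mx_norm_le_enorm v : `|v| <= (enorm v)%:C.
Proof.
have [->|v0] := eqVneq v 0; first by rewrite normr0 enorm0.
have : mx_norm v != 0 by rewrite -[mx_norm v]/(`|v|) normr_eq0.
move=> /mx_norm_neq0[[i j] /= vij]; rewrite [leLHS]vij.
by rewrite (ord1 j) normcE lecR entry_le_enorm.
Qed.

Lemma entry_le_mx_norm v j : `|v j 0| <= `|v|.
Proof.
rewrite [leRHS]/Num.norm/= mx_normE -[leLHS]nngE num_le.
by apply/bigmax_geP; right; exists (j, 0); rewrite // lexx.
Qed.

Lemma enorm_le_mx_norm v : (enorm v)%:C <= k%:R * `|v|.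
Proof.
apply: le_trans (_ : (\sum_(j < k) normc (v j 0))%:C <= _).
  by rewrite lecR enorm_le_sum.
rewrite rmorph_sum/=; apply: le_trans (_ : \sum_(j < k) `|v| <= _).
  by apply: ler_sum => j _; rewrite -normcE entry_le_mx_norm.
by rewrite sumr_const card_ord mulr_natl.
Qed.

Lemma nbhs_enorm u (P : set Ck) :
  nbhs u P <-> exists2 e : R, 0 < e & forall v, enorm (v - u) < e -> P v.
Proof.
split.
  move=> /(iffLR (@nbhs_normP _ Ck u P))[[e1 e2]/=]; rewrite /mkset ltcE/= => /andP[/eqP -> e0] h.
  exists e1 => // v uv; apply: h => /=.
  by rewrite distrC (le_lt_trans (mx_norm_le_enorm _))// ltcR.
move=> [e e0 h]; apply: (iffRL (@nbhs_normP _ Ck u P)).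
(* Comparing the norms costs a factor [k]; [k.+1] keeps the divisor nonzero when [k = 0]. *)
have k0 : 0 < k.+1%:R :> R by rewrite ltr0n.
exists (e / k.+1%:R)%:C => /=; first by rewrite /mkset ltcR divr_gt0.
move=> v /=; rewrite distrC => vu; apply: h; rewrite -ltcR.
apply: le_lt_trans (enorm_le_mx_norm _) _.
apply: le_lt_trans (_ : k.+1%:R * `|v - u| < _); first by rewrite ler_wpM2r// ler_nat.
have -> : e%:C = k.+1%:R * (e / k.+1%:R)%:C.
  by rewrite -[k.+1%:R in RHS](rmorph_nat (real_complex R)) -rmorphM/= mulrCA mulfV ?mulr1// gt_eqF.
by rewrite ltr_pM2l// ltr0n.
Qed.

End EuclideanNorm.
#[local] Hint Extern 0 (is_true (0 <= enorm _)) => exact: enorm_ge0 : core.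

(** * Complex derivatives and the mean value inequality *)

Section ComplexDerivative.
Context {R : realType} {k : nat}.
Local Notation Ck := 'cV[R[i]]_k.
Implicit Types (u v w : Ck) (g h : Ck -> Ck) (L : 'M[R[i]]_k).

(** The derivative with its matrix explicit, a real [e] and Hermitian norms, so that estimates do
    not pass through the [R[i]]-valued max norm. *)
Definition hasD g w L := forall e : R, 0 < e -> exists2 rho : R, 0 < rho &
  forall v, enorm (v - w) < rho ->
    enorm (g v - g w - L *m (v - w)) <= e * enorm (v - w).

Lemma jac_mulmx g w v : jac g w *m v = 'd g w v.
Proof.
rewrite {2}[v]matrix_sum_delta linear_sum; apply/colP => i.
rewrite mxE summxE; apply: eq_bigr => j _.
by rewrite big_ord1 linearZ !mxE mulrC.
Qed.

Lemma derive_jac g w v : differentiable g w -> 'D_v g w = jac g w *m v.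
Proof. by move=> gw; rewrite jac_mulmx (deriveE v gw). Qed.

Lemma differentiable_hasD g w : differentiable g w -> hasD g w (jac g w).
Proof.
move=> /diff_locallyP[_ /eqaddoP gw] e e0.
have k0 : 0 < k.+1%:R :> R by rewrite ltr0n.
have : 0 < (e / k.+1%:R)%:C by rewrite ltcR divr_gt0.
move=> /gw/nbhs_enorm[rho rho0 h]; exists rho => // v vw.
have := h (v - w); rewrite subr0 => /(_ vw).
rewrite -[((_ - _ : _ -> _) (v - w))]/(g (v - w + w) - (g w + 'd g w (v - w))).
rewrite subrK opprD addrA -jac_mulmx => {}h; rewrite -lecR.
apply: le_trans (enorm_le_mx_norm _) _.
apply: le_trans (_ : k.+1%:R * ((e / k.+1%:R)%:C * `|v - w|) <= _).
  by rewrite ler_pM// ler_nat.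
rewrite mulrA -[k.+1%:R in leLHS](rmorph_nat (real_complex R)) -rmorphM/=.
rewrite mulrCA mulfV ?gt_eqF// mulr1 rmorphM/=.
by rewrite ler_wpM2l ?mx_norm_le_enorm// ler0c ltW.
Qed.

Lemma continuous_mulmx L : continuous (mulmx L : Ck -> Ck).
Proof.
move=> w A /nbhs_enorm[e e0 hA]; apply/nbhs_enorm.
have [B B0 hB] := enorm_mulmx_bound L.
exists (e / B) => [|v vw]; first by rewrite divr_gt0.
apply: hA; rewrite -mulmxBr (le_lt_trans (hB _))//.
by rewrite mulrC -ltr_pdivlMr.
Qed.

Lemma hasD_diff g w L : hasD g w L -> differentiable g w /\ jac g w = L.
Proof.
move=> gw.
have loc (e : R[i]) : 0 < e -> \forall v \near (0 : Ck),
    `|g (v + w) - (g w + L *m v)| <= e * `|v|.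
  case: e => [e1 e2]; rewrite ltcE/= => /andP[/eqP -> e0].
  have k0 : 0 < k.+1%:R :> R by rewrite ltr0n.
  have [rho rho0 h] := gw _ (divr_gt0 e0 k0).
  apply/nbhs_enorm; exists rho => // v; rewrite subr0 => vr.
  have := h (v + w); rewrite addrK => /(_ vr) {}h.
  rewrite opprD addrA; apply: le_trans (mx_norm_le_enorm _) _.
  apply: le_trans (_ : (e1 / k.+1%:R * enorm v)%:C <= _); first by rewrite lecR.
  rewrite -mulrA rmorphM/=; apply: ler_wpM2l; first by rewrite ler0c ltW.
  rewrite rmorphM/= fmorphV rmorph_nat.
  rewrite ler_pdivrMl ?ltr0n// (le_trans (enorm_le_mx_norm _))// ler_wpM2r//.
  by rewrite ler_nat.
have dL : 'd g w = mulmx L :> (Ck -> Ck).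
  apply: diff_unique; first exact: continuous_mulmx.
  by apply/eqaddoP => e; exact: loc.
split.
  apply/diff_locallyP; rewrite dL; split; first exact: continuous_mulmx.
  by apply/eqaddoP => e; exact: loc.
apply/matrixP => i j; rewrite mxE dL.
by rewrite -colE mxE.
Qed.

Lemma hasD_affine (b : Ck) L w : hasD (fun v => b + L *m v) w L.
Proof.
move=> e e0; exists 1 => // v _.
rewrite opprD addrACA subrr add0r -mulmxBr subrr enorm0.
by rewrite mulr_ge0// ltW.
Qed.

Lemma hasD_near g h w L : hasD g w L -> (\forall v \near w, h v = g v) ->
  hasD h w L.
Proof.
move=> gw /nbhs_enorm[r r0 hr] e e0; have [rho rho0 H] := gw _ e0.
exists (Num.min r rho) => [|v]; first by rewrite lt_min r0.
rewrite lt_min => /andP[vr vrho]; rewrite !hr ?H//.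
by rewrite subrr enorm0.
Qed.

Lemma hasD_lipschitz g w L (B e : R) : 0 < e -> hasD g w L ->
  (forall v, enorm (L *m v) <= B * enorm v) ->
  exists2 rho : R, 0 < rho & forall v, enorm (v - w) < rho ->
    enorm (g v - g w) <= (B + e) * enorm (v - w).
Proof.
move=> e0 gw LB; have [rho rho0 H] := gw _ e0; exists rho => // v /H {}H.
rewrite -(subrK (L *m (v - w)) (g v - g w)) (le_trans (enormD _ _))//.
by rewrite mulrDl addrC lerD.
Qed.

Lemma hasD_continuous g w L : hasD g w L -> {for w, continuous g}.
Proof. by move=> /hasD_diff[/differentiable_continuous]. Qed.

Lemma hasD_comp g h w L L' : hasD g w L -> hasD h (g w) L' ->
  hasD (h \o g) w (L' *m L).
Proof.
move=> gw hgw e e0.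
have [B B0 LB] := enorm_mulmx_bound L; have [B' B'0 LB'] := enorm_mulmx_bound L'.
have [r1 r10 H1] := hasD_lipschitz ltr01 gw LB.
have e2 : 0 < e / 2 by rewrite divr_gt0.
have [r2 r20 H2] := gw _ (divr_gt0 e2 B'0).
have B1 : 0 < B + 1 by rewrite addr_gt0.
have [r3 r30 H3] := hgw _ (divr_gt0 e2 B1).
exists (Num.min (Num.min r1 r2) (r3 / (B + 1))).
  by rewrite !lt_min r10 r20 divr_gt0.
move=> v; rewrite !lt_min => /andP[/andP[/H1 {}H1 /H2 {}H2]].
rewrite ltr_pdivlMr// mulrC => vr3.
have {}H3 := H3 _ (le_lt_trans H1 vr3).
have -> : (h \o g) v - (h \o g) w - L' *m L *m (v - w) =
  (h (g v) - h (g w) - L' *m (g v - g w)) +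
  L' *m (g v - g w - L *m (v - w)).
  by rewrite (mulmxBr _ (g v - g w)) mulmxA addrA subrK.
apply: le_trans (enormD _ _) _; rewrite [e]splitr mulrDl lerD//.
  apply: le_trans H3 _; rewrite -mulrA ler_wpM2l ?(ltW e2)//.
  by rewrite ler_pdivrMl.
apply: le_trans (LB' _) _; rewrite mulrC -ler_pdivlMr//.
by apply: le_trans H2 _; rewrite mulrAC.
Qed.

Lemma hasD_unique g w L L' : hasD g w L -> hasD g w L' -> L = L'.
Proof. by move=> /hasD_diff[_ <-] /hasD_diff[_]. Qed.

End ComplexDerivative.

(* Real induction along [0, 1]: a path that is pointwise [K]-Lipschitz for a
   pseudo-distance is globally so. It yields the mean value inequality as well
   as length estimates in the manifold. *)
Lemma lipschitz_path {R : realType} (d : R -> R -> R) (K : R) :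
  (forall t, d t t = 0) -> (forall r s t, d r t <= d r s + d s t) ->
  (forall s t, d s t = d t s) ->
  (forall t, 0 <= t <= 1 -> exists2 rho, 0 < rho &
    forall s, 0 <= s <= 1 -> `|s - t| < rho -> d t s <= K * `|s - t|) ->
  d 0 1 <= K.
Proof.
move=> d0 dtri dsym loc.
pose S := [set t | 0 <= t <= 1 /\ d 0 t <= K * t].
have S0 : S 0 by rewrite /S/= lexx ler01 d0 mulr0.
have hs : has_sup S by split; [exists 0 | exists 1 => t [/andP[]]].
have c0 : 0 <= sup S by apply: ub_le_sup => //; exact: hs.2.
have c1 : sup S <= 1 by apply: ge_sup; [exists 0 | move=> t [/andP[]]].
have [|rho rho0 hrho] := loc (sup S); first by rewrite c0.
have Sc : d 0 (sup S) <= K * sup S.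
  have [t St ht] := sup_adherent rho0 hs; case: (St) => t01 dt.
  have tc : t <= sup S by apply: ub_le_sup => //; exact: hs.2.
  have ts : `|t - sup S| = sup S - t by rewrite distrC ger0_norm// subr_ge0.
  have dts : d t (sup S) <= K * (sup S - t) by rewrite dsym -ts hrho// ts; lra.
  apply: le_trans (dtri _ t _) _; apply: le_trans (lerD dt dts) _.
  by rewrite -mulrDr [t + _]addrC subrK.
have [c1'|c1'] := ltP (sup S) 1; last first.
  by move: Sc; rewrite (_ : sup S = 1) ?mulr1//; apply/eqP; rewrite eq_le c1.
pose t := Num.min 1 (sup S + rho / 2).
have tc : sup S < t by rewrite lt_min c1' ltrDl divr_gt0.
have t1 : t <= 1 by rewrite ge_min lexx.
have ts : `|t - sup S| = t - sup S by rewrite ger0_norm// subr_ge0 ltW.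
have tr : t - sup S < rho.
  have : t <= sup S + rho / 2 by rewrite ge_min lexx orbT.
  by lra.
suff : t <= sup S by rewrite leNgt tc.
apply: ub_le_sup; first exact: hs.2.
split; first by rewrite t1 (le_trans c0 (ltW tc)).
have dst : d (sup S) t <= K * (t - sup S).
  by rewrite -ts hrho// ?ts// t1 (le_trans c0 (ltW tc)).
apply: le_trans (dtri _ (sup S) _) _; apply: le_trans (lerD Sc dst) _.
by rewrite -mulrDr [sup S + _]addrC subrK.
Qed.

Section MeanValue.
Context {R : realType} {k : nat}.
Local Notation Ck := 'cV[R[i]]_k.

(** The vector [c] makes one inequality serve for increments ([c = 0]) and for remainders ([c] the
    increment of a linear part): the path [g (a + t v) - t c] is pointwise [(B + e)]-Lipschitz. *)
Lemma mean_value_inequality (g : Ck -> Ck) (L : Ck -> 'M[R[i]]_k) (a v c : Ck) (B : R) :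
  (forall t : R, 0 <= t <= 1 -> hasD g (a + t%:C *: v) (L (a + t%:C *: v)) /\
    enorm (L (a + t%:C *: v) *m v - c) <= B) ->
  enorm (g (a + v) - g a - c) <= B.
Proof.
move=> H; apply/ler_addgt0Pr => e e0.
pose p (t : R) := g (a + t%:C *: v) - t%:C *: c.
pose d s t := enorm (p s - p t).
have -> : g (a + v) - g a - c = p 1 - p 0.
  by rewrite /p !scale0r !scale1r addr0 subr0 addrAC.
rewrite -/(d 1 0) {1}/d enorm_distC -/(d 0 1).
apply: lipschitz_path.
- by move=> t; rewrite /d subrr enorm0.
- by move=> r s t; exact: enorm_dist.
- by move=> s t; exact: enorm_distC.
move=> t /H[gD gB].
have e1 : 0 < e / (enorm v + 1) by rewrite divr_gt0// ltr_wpDl.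
have [rho rho0 h] := gD _ e1.
exists (rho / (enorm v + 1)) => [|s _ st]; first by rewrite divr_gt0// ltr_wpDl.
have vv : a + s%:C *: v - (a + t%:C *: v) = (s - t)%:C *: v.
  by rewrite opprD addrACA subrr add0r -scalerBl rmorphB.
have := h (a + s%:C *: v); rewrite vv enormZr => {}h.
have v1 : enorm v <= enorm v + 1 by rewrite lerDl.
have v0 : 0 < enorm v + 1 by rewrite ltr_wpDl.
have : `|s - t| * enorm v < rho.
  by move: st; rewrite ltr_pdivlMr//; apply: le_lt_trans; rewrite ler_wpM2l.
move=> /h{}h; rewrite /d enorm_distC /p.
have -> : g (a + s%:C *: v) - s%:C *: c - (g (a + t%:C *: v) - t%:C *: c) =
  g (a + s%:C *: v) - g (a + t%:C *: v) - L (a + t%:C *: v) *m ((s - t)%:C *: v)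
  + (s - t)%:C *: (L (a + t%:C *: v) *m v - c).
  rewrite -scalemxAr; move: (L _ *m v) (g _) (g _) => y1 y2 y3.
  by apply/colP => i; rewrite !mxE rmorphB/=; ring.
apply: le_trans (enormD _ _) _; rewrite mulrDl addrC enormZr lerD//.
  by rewrite mulrC ler_wpM2r.
apply: le_trans h _; rewrite mulrCA [leRHS]mulrC ler_wpM2l//.
by rewrite mulrAC ler_pdivrMr// ler_wpM2l// ltW.
Qed.

(** Mean value inequality for ['D_v g] along the segment from [0] to [w], which stays in the
    ball. *)
Lemma D2_lipschitz (g : Ck -> Ck) (r a : R) : 0 < a ->
  (forall w, enorm w <= r -> differentiable g w /\ norm_D2_le g w a) ->
  forall w v, enorm w <= r ->
  enorm (jac g w *m v - jac g 0 *m v) <= a * enorm w * enorm v.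
Proof.
move=> a0 H w v wr.
have in_ball (t : R) : 0 <= t <= 1 -> enorm (0 + t%:C *: w) <= r.
  move=> /andP[t0 t1]; rewrite add0r enormZr ger0_norm//.
  by apply: le_trans wr; rewrite ler_piMl.
have r0 : enorm (0 : Ck) <= r by rewrite enorm0 (le_trans (enorm_ge0 w)).
have aux (a1 a2 b1 b2 : Ck) (B : R) : a1 = b1 -> a2 = b2 ->
  enorm (a1 - a2) <= B -> enorm (b1 - b2) <= B by move=> -> ->.
apply: (aux _ _ _ _ _ (derive_jac v (H w wr).1) (derive_jac v (H 0 r0).1)).
have := @mean_value_inequality ('D_v g) (jac ('D_v g)) 0 w 0 (a * enorm w * enorm v).
rewrite subr0 add0r; apply => t /in_ball/H[gd [Dd Db]]; split.
  exact/differentiable_hasD/Dd.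
by rewrite subr0 -(derive_jac _ (Dd v)).
Qed.

(** On the ball the derivative differs from [jac g 0] by at most [a * r], so a small radius makes
    the nonlinear part a strong contraction. *)
Lemma remainder_lipschitz (g : Ck -> Ck) (r a : R) : 0 < a ->
  (forall w, enorm w <= r -> differentiable g w /\ norm_D2_le g w a) ->
  forall w v, enorm w <= r -> enorm v <= r ->
  enorm ((g w - jac g 0 *m w) - (g v - jac g 0 *m v)) <= a * r * enorm (w - v).
Proof.
move=> a0 H w v wr vr.
have -> : g w - jac g 0 *m w - (g v - jac g 0 *m v) =
  g (v + (w - v)) - g v - jac g 0 *m (w - v).
  rewrite [v + _]addrC subrK mulmxBr.
  move: (g w) (g v) (_ *m w) (_ *m v) => y1 y2 y3 y4.
  by apply/colP => i; rewrite !mxE; ring.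
apply: (@mean_value_inequality _ (jac g)) => t /andP[t0 t1].
have pr : enorm (v + t%:C *: (w - v)) <= r.
  have -> : v + t%:C *: (w - v) = t%:C *: w + (1 - t)%:C *: v.
    by apply/colP => i; rewrite !mxE rmorphB/=; ring.
  apply: le_trans (enormD _ _) _; rewrite !enormZr !ger0_norm ?subr_ge0//.
  have -> : r = t * r + (1 - t) * r by ring.
  by rewrite lerD// ler_wpM2l// subr_ge0.
have [gd _] := H _ pr; split; first exact: differentiable_hasD.
apply: le_trans (D2_lipschitz a0 H _ pr) _.
by rewrite ler_wpM2r// ler_wpM2l// ltW.
Qed.

End MeanValue.

(** * Fixed points of cyclic hyperbolic sequences *)

Section Picard.
Context {R : realType}.

Lemma le_of_geometric (q D x y : R) : 0 <= q < 1 ->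
  (forall n, x <= y + D * q ^+ n) -> x <= y.
Proof.
move=> /andP[q0 q1] h; apply/ler_addgt0Pr => e e0.
have qcvg : (fun n => D * q ^+ n) @ \oo --> (0 : R).
  rewrite -(mulr0 D); apply: cvgMr; apply: cvg_expr; first by rewrite ger0_norm.
move: qcvg => /cvgrPdist_lt/(_ e e0)[n _ /(_ n (leqnn n))/=].
rewrite sub0r normrN => hn; apply: le_trans (h n) _.
by rewrite lerD2l (le_trans (ler_norm _))// ltW.
Qed.

(* [x n - c q^n] increases and [x n + c q^n] decreases. *)
Lemma geometric_limit (q C : R) (x : nat -> R) : 0 <= q < 1 ->
  (forall n, `|x n.+1 - x n| <= C * q ^+ n) ->
  exists l, forall n, `|l - x n| <= C / (1 - q) * q ^+ n.
Proof.
move=> /andP[q0 q1] h; set c := C / (1 - q).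
have cE n : C * q ^+ n = c * q ^+ n - c * q ^+ n.+1.
  by rewrite exprS /c; field; rewrite subr_eq0 gt_eqF.
have C0 : 0 <= C by have := h 0%N; rewrite expr0 mulr1; apply: le_trans.
have c0 n : 0 <= c * q ^+ n by rewrite mulr_ge0 ?exprn_ge0// divr_ge0// subr_ge0 ltW.
have inc : {homo (fun n => x n - c * q ^+ n) : n m / (n <= m)%N >-> n <= m}.
  by apply/nondecreasing_seqP => n; have := h n; rewrite cE ler_norml => /andP[? ?]; lra.
have dec : {homo (fun n => x n + c * q ^+ n) : n m / (n <= m)%N >-> m <= n}.
  by apply/nonincreasing_seqP => n; have := h n; rewrite cE ler_norml => /andP[? ?]; lra.
have bnd n m : x n - c * q ^+ n <= x m + c * q ^+ m.
  have := inc _ _ (leq_maxl n m); have := dec _ _ (leq_maxr n m).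
  by have := c0 (maxn n m); lra.
pose S := range (fun n => x n - c * q ^+ n).
have S0 : S !=set0 by exists (x 0%N - c * q ^+ 0); exists 0%N.
exists (sup S) => n; rewrite ler_distl; apply/andP; split.
  apply: ub_le_sup; last by exists n.
  by exists (x 0%N + c * q ^+ 0) => _ [m _ <-].
by apply: ge_sup => // _ [m _ <-].
Qed.

Context {k : nat}.
Local Notation Ck := 'cV[R[i]]_k.

Lemma geometric_limit_vector (q C : R) (x : nat -> Ck) : 0 <= q < 1 ->
  (forall n, enorm (x n.+1 - x n) <= C * q ^+ n) ->
  exists l, forall n, enorm (l - x n) <= k%:R * (2 * (C / (1 - q))) * q ^+ n.
Proof.
move=> q01 h.
have hj j n : Normc.normc (x n.+1 j 0 - x n j 0) <= C * q ^+ n.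
  by have := entry_le_enorm (x n.+1 - x n) j; rewrite !mxE => /le_trans; apply.
have lre j : exists l, forall n,
    `|l - complex.Re (x n j 0)| <= C / (1 - q) * q ^+ n.
  apply: geometric_limit => // n; apply: le_trans (hj j n).
  by apply: le_trans (Re_le_normc _); case: (x n.+1 j 0) (x n j 0) => ? ? [].
have lim j : exists l, forall n,
    `|l - complex.Im (x n j 0)| <= C / (1 - q) * q ^+ n.
  apply: geometric_limit => // n; apply: le_trans (hj j n).
  by apply: le_trans (Im_le_normc _); case: (x n.+1 j 0) (x n j 0) => ? ? [].
have [lr hr] := choice lre; have [li hi] := choice lim.
exists (\col_j (lr j +i* li j)) => n; apply: le_trans (enorm_le_sum _) _.
rewrite -!mulrA -[k in leRHS]card_ord mulr_natl -sumr_const.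
apply: ler_sum => j _; rewrite !mxE.
apply: le_trans (normc_le_Re_Im _) _.
rewrite mulr2n mulrDl mul1r -mulr2n mulrA.
have := hr j n; have := hi j n; case: (x n j 0) => a b /=; lra.
Qed.

(** Banach's theorem in the unit ball of the norm [sup_j nrm (w j) / rho j]. Limits are taken in
    [enorm] for each [j] and carried over to [nrm] by comparability. The bound on [Phi 0] keeps the
    ball invariant, as [q + (1 - q) = 1]. *)
Lemma weighted_fixpoint (J : Type) (Phi : (J -> Ck) -> J -> Ck) (nrm : Ck -> R)
    (rho : J -> R) (q : R) :
  (forall v, nrm v <= enorm v <= 2 * nrm v) ->
  (forall u v, nrm (u + v) <= nrm u + nrm v) ->
  (forall j, 0 < rho j) -> 0 <= q < 1 ->
  (forall w w' t, (forall j, nrm (w j) <= rho j) ->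
     (forall j, nrm (w' j) <= rho j) ->
     (forall j, nrm (w j - w' j) <= t * rho j) ->
     forall j, nrm (Phi w j - Phi w' j) <= q * t * rho j) ->
  (forall j, nrm (Phi (fun=> 0) j) <= (1 - q) * rho j) ->
  exists w, (forall j, nrm (w j) <= rho j) /\ forall j, Phi w j = w j.
Proof.
move=> nE nD rho0 q01 ctr H0; have /andP[q0 q1] := q01.
have n0 : nrm 0 = 0.
  by apply/eqP; have /andP[] := nE 0; rewrite enorm0 eq_le => ->; rewrite pmulr_rge0.
pose W n := iter n Phi (fun=> 0).
have Wb n j : nrm (W n j) <= rho j.
  elim: n j => [|n ih] j; first by rewrite n0 ltW.
  rewrite /W iterS -/(W n) -(subrK (Phi (fun=> 0) j) (Phi (W n) j)).
  apply: le_trans (nD _ _) _.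
  have -> : rho j = q * 1 * rho j + (1 - q) * rho j by ring.
  apply: lerD => //; apply: ctr => // i; first by rewrite n0 ltW.
  by rewrite subr0 mul1r.
have Wd n j : nrm (W n.+1 j - W n j) <= q ^+ n * rho j.
  elim: n j => [|n ih] j; first by rewrite subr0 expr0 mul1r; exact: (Wb 1%N).
  by rewrite exprS; exact: (ctr (W n.+1) (W n) _ (Wb n.+1) (Wb n) ih).
have lim j : exists l, forall n,
    enorm (l - W n j) <= k%:R * (2 * (2 * rho j / (1 - q))) * q ^+ n.
  apply: geometric_limit_vector => // n.
  have /andP[_ /le_trans] := nE (W n.+1 j - W n j); apply.
  by rewrite -mulrA ler_pM2l// mulrC.
have {lim}[w hw] := choice lim.
(* The constant [D] is common to all [j]: [w] and [W n] are at distance at most [D * q ^+ n] in the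
   weighted norm, so [ctr] applies to this pair. *)
pose D := k%:R * (2 * (2 / (1 - q))).
have wW n j : nrm (w j - W n j) <= D * q ^+ n * rho j.
  have /andP[/le_trans h _] := nE (w j - W n j); apply: h.
  by apply: le_trans (hw j n) _; rewrite /D le_eqVlt; apply/orP; left; apply/eqP; ring.
have Ww n j : nrm (W n j - w j) <= D * q ^+ n * rho j.
  have /andP[/le_trans h _] := nE (W n j - w j); apply: h; rewrite enorm_distC.
  by apply: le_trans (hw j n) _; rewrite /D le_eqVlt; apply/orP; left; apply/eqP; ring.
have wb j : nrm (w j) <= rho j.
  apply: (le_of_geometric (D := D * rho j) q01) => n.
  rewrite -(subrK (W n j) (w j)) (le_trans (nD _ _))// addrC lerD//.
  by rewrite mulrAC.
exists w; split => // j; apply/eqP; rewrite -subr_eq0; apply/eqP/enorm0_eq0/eqP.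
rewrite eq_le enorm_ge0 andbT; have /andP[_ /le_trans] := nE (Phi w j - w j); apply.
rewrite pmulr_rle0//; apply: (le_of_geometric (D := q * D * rho j + q * D * rho j) q01) => n.
rewrite -(subrKA (W n.+1 j)) (le_trans (nD _ _))// add0r mulrDl lerD//.
  by rewrite mulrAC -(mulrA q); apply: ctr.
by apply: le_trans (Ww _ _) _; rewrite exprS le_eqVlt; apply/orP; left; apply/eqP; ring.
Qed.

End Picard.

(** * Cyclic sequences close to a hyperbolic linear one *)

Section CyclicHyperbolic.
Context {R : realType} {k m : nat}.
Local Notation Ck := 'cV[R[i]]_k.
Variables (Pu : 'M[R[i]]_k) (A : 'I_m -> 'M[R[i]]_k) (sigma theta : R).
Hypothesis Pu_idem : Pu *m Pu = Pu.
Hypothesis Pu_le : forall v, enorm (Pu *m v) <= enorm v.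
Hypothesis Ps_le : forall v, enorm (v - Pu *m v) <= enorm v.
Hypothesis sigma01 : 0 <= sigma <= 1.
Hypothesis theta0 : 0 <= theta.
Hypothesis A_comm : forall j, A j *m Pu = Pu *m A j.
Hypothesis A_stable : forall j v,
  enorm (A j *m (v - Pu *m v)) <= sigma * enorm (v - Pu *m v).
Hypothesis A_unstable : forall j v,
  enorm (Pu *m v) <= sigma * enorm (A j *m (Pu *m v)).

(** With the maximum of the two components, the stable and unstable estimates are proved separately,
    each with the full contraction factor. Returning to [enorm] costs the [2] of [2 * theta]. *)
Let nrm (v : Ck) : R := Num.max (enorm (Pu *m v)) (enorm (v - Pu *m v)).

Let nrm_enorm v : nrm v <= enorm v <= 2 * nrm v.
Proof.
rewrite ge_max Pu_le Ps_le/= -{1}(subrK (Pu *m v) v) mulr2n mulrDl mul1r.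
by rewrite (le_trans (enormD _ _))// lerD// le_max lexx ?orbT.
Qed.

Let nrmD u v : nrm (u + v) <= nrm u + nrm v.
Proof.
rewrite ge_max mulmxDr; apply/andP; split.
  by rewrite (le_trans (enormD _ _))// lerD// le_max lexx.
by rewrite opprD addrACA (le_trans (enormD _ _))// lerD// le_max lexx orbT.
Qed.

Let u_le v : enorm (Pu *m v) <= nrm v. Proof. by rewrite le_max lexx. Qed.
Let s_le v : enorm (v - Pu *m v) <= nrm v. Proof. by rewrite le_max lexx orbT. Qed.
Let n_le v : enorm v <= 2 * nrm v. Proof. by case/andP: (nrm_enorm v). Qed.

(** [A j] may be singular on the stable part. Replacing it there by the identity gives an invertible
    matrix [A'] that agrees with [A j] on the unstable part; [B] is its inverse. *)
Lemma unstable_inverse j : exists B : 'M[R[i]]_k,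
  [/\ B *m Pu = Pu *m B, A j *m B *m Pu = Pu &
      forall v, enorm (B *m (Pu *m v)) <= sigma * enorm (Pu *m v)].
Proof.
pose A' := A j *m Pu + (1%:M - Pu).
have PA : Pu *m A' = A' *m Pu.
  rewrite /A' mulmxDr mulmxDl mulmxBr mulmxBl mulmx1 mul1mx Pu_idem.
  by rewrite mulmxA -A_comm.
have APu : A' *m Pu = A j *m Pu.
  by rewrite mulmxDl mulmxBl mul1mx Pu_idem subrr addr0 -mulmxA Pu_idem.
have uA : A' \in unitmx.
  rewrite -unitmx_tr -row_free_unit; apply: inj_row_free => v vA.
  have {vA} : A' *m v^T = 0 by rewrite -[A']trmxK -trmx_mul vA trmx0.
  move: (v^T) (trmxK v) => u <- uA.
  have Pu0 : Pu *m u = 0.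
    apply: enorm0_eq0; apply/eqP; rewrite eq_le enorm_ge0 andbT.
    apply: le_trans (A_unstable j u) _.
    by rewrite mulmxA -APu -PA -mulmxA uA mulmx0 enorm0 mulr0.
  move: uA; rewrite mulmxDl -mulmxA Pu0 mulmx0 add0r mulmxBl mul1mx Pu0 subr0 => ->.
  by rewrite trmx0.
have comm : invmx A' *m Pu = Pu *m invmx A'.
  by rewrite -[in LHS](mulmxK uA Pu) PA mulmxA mulKmx.
have AB : A j *m invmx A' *m Pu = Pu.
  by rewrite -mulmxA comm mulmxA -APu -PA -mulmxA mulmxV ?mulmx1.
exists (invmx A'); split=> // v.
have {1}-> : invmx A' *m (Pu *m v) = Pu *m (invmx A' *m (Pu *m v)).
  by rewrite !mulmxA -comm -(mulmxA _ Pu Pu) Pu_idem.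
apply: le_trans (A_unstable j _) _.
have ABv : A j *m (invmx A' *m (Pu *m v)) = Pu *m v by rewrite !mulmxA AB.
by rewrite mulmxA A_comm -mulmxA ABv mulmxA Pu_idem.
Qed.

(* A shadowing periodic orbit is the fixed point of the operator which pushes
   stable components forward and pulls unstable components back. *)
Lemma cyclic_orbit (N : 'I_m -> Ck -> Ck) (rho : 'I_m -> R) (tau q : R) :
  1 <= tau -> q = (sigma + 2 * theta) * tau -> q < 1 ->
  (forall j, 0 < rho j) ->
  (forall j, rho j <= tau * rho (ordS j)) ->
  (forall j, rho (ordS j) <= tau * rho j) ->
  (forall j w w', enorm w <= 2 * rho j -> enorm w' <= 2 * rho j ->
     enorm (N j w - N j w') <= theta * enorm (w - w')) ->
  (forall j, enorm (N j 0) <= (1 - q) * rho (ordS j)) ->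
  (forall j, sigma * enorm (N j 0) <= (1 - q) * rho j) ->
  exists w : 'I_m -> Ck, (forall j, enorm (w j) <= 2 * rho j) /\
    forall j, w (ordS j) = A j *m w j + N j (w j).
Proof.
move=> tau1 qE q1 rho0 rho_up rho_dn NL N0 N0'.
have /andP[s0 s1] := sigma01.
have q0 : 0 <= q by rewrite qE mulr_ge0 ?addr_ge0 ?mulr_ge0// (le_trans ler01).
have [B hB] := choice unstable_inverse.
pose X (w : 'I_m -> Ck) j := A j *m w j + N j (w j).
(* The unstable summand solves the unstable half of the orbit equation at [j] for [Pu *m w j]. Index
   [j] thus looks at both neighbours, and weights are compared in both directions. *)
pose Phi w j := (X w (ord_pred j) - Pu *m X w (ord_pred j)) +
  B j *m (Pu *m (w (ordS j) - N j (w j))).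
have PuPhi w j : Pu *m Phi w j = B j *m (Pu *m (w (ordS j) - N j (w j))).
  have [hc _ _] := hB j.
  rewrite mulmxDr mulmxBr (mulmxA Pu Pu) Pu_idem subrr add0r !mulmxA -hc.
  by rewrite -(mulmxA (B j) Pu Pu) Pu_idem.
have PsPhi w j : Phi w j - Pu *m Phi w j = X w (ord_pred j) - Pu *m X w (ord_pred j).
  by rewrite PuPhi addrK.
have XE w j : X w j = A j *m w j + N j (w j) by [].
clearbody Phi X.
have wball w j : nrm (w j) <= rho j -> enorm (w j) <= 2 * rho j.
  by move=> h; rewrite (le_trans (n_le _))// ler_pM2l.
have ctr w w' t : (forall j, nrm (w j) <= rho j) ->
     (forall j, nrm (w' j) <= rho j) ->
     (forall j, nrm (w j - w' j) <= t * rho j) ->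
     forall j, nrm (Phi w j - Phi w' j) <= q * t * rho j.
  move=> wb wb' wt j.
  have t0 : 0 <= t.
    have : 0 <= t * rho j by rewrite (le_trans _ (wt j))// (le_trans _ (u_le _)).
    by rewrite pmulr_lge0.
  have dN i : enorm (N i (w i) - N i (w' i)) <= 2 * theta * (t * rho i).
    apply: le_trans (NL _ _ _ (wball _ _ (wb i)) (wball _ _ (wb' i))) _.
    rewrite [2 * theta]mulrC -mulrA ler_wpM2l// (le_trans (n_le _))//.
    by rewrite ler_pM2l.
  rewrite ge_max; apply/andP; split.
    rewrite mulmxBr !PuPhi -!mulmxBr; have [_ _ hs] := hB j.
    apply: le_trans (hs _) _.
    have -> : w (ordS j) - N j (w j) - (w' (ordS j) - N j (w' j)) =
       (w (ordS j) - w' (ordS j)) - (N j (w j) - N j (w' j)).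
      by apply/colP => i; rewrite !mxE; ring.
    rewrite mulmxBr; apply: (@le_trans _ _ (sigma * (t * rho (ordS j) + 2 * theta * (t * rho j)))).
      rewrite ler_wpM2l// (le_trans (enormB _ _))// lerD//.
        exact: le_trans (u_le _) (wt _).
      exact: le_trans (Pu_le _) (dN _).
    apply: (@le_trans _ _ (sigma * (t * (tau * rho j) + 2 * theta * (t * rho j)))).
      by rewrite ler_wpM2l// lerD2r ler_wpM2l.
    have : sigma * (2 * theta * (t * rho j)) <= tau * (2 * theta * (t * rho j)).
      by rewrite ler_wpM2r ?(le_trans s1 tau1)// !mulr_ge0// ltW.
    by rewrite qE; lra.
  rewrite mulmxBr opprB addrA [X in enorm X](_ : _ =
    (Phi w j - Pu *m Phi w j) - (Phi w' j - Pu *m Phi w' j)); last first.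
    move: (Phi w j) (Phi w' j) (_ *m _) (_ *m _) => y1 y2 y3 y4.
    by apply/colP => i; rewrite !mxE; ring.
  rewrite !PsPhi; set i := ord_pred j.
  have -> : X w i - Pu *m X w i - (X w' i - Pu *m X w' i) =
     A i *m ((w i - w' i) - Pu *m (w i - w' i)) +
     ((N i (w i) - N i (w' i)) - Pu *m (N i (w i) - N i (w' i))).
    rewrite !XE !mulmxBr !mulmxDr (mulmxA (A i) Pu) (mulmxA (A i) Pu) A_comm.
    rewrite -!mulmxA.
    by apply/colP => a; rewrite !mxE; ring.
  apply: le_trans (enormD _ _) _.
  apply: (@le_trans _ _ (sigma * (t * rho i) + 2 * theta * (t * rho i))).
    apply: lerD; last by apply: le_trans (Ps_le _) (dN _).
    apply: le_trans (A_stable _ _) _; rewrite ler_wpM2l//.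
    exact: le_trans (s_le _) (wt _).
  have : rho i <= tau * rho j by have := rho_up i; rewrite /i ord_predK.
  move=> ri; have : (sigma + 2 * theta) * t * rho i <= (sigma + 2 * theta) * t * (tau * rho j).
    by rewrite ler_wpM2l// !mulr_ge0// addr_ge0// mulr_ge0.
  by rewrite qE; lra.
have H0 j : nrm (Phi (fun=> 0) j) <= (1 - q) * rho j.
  rewrite ge_max; apply/andP; split.
    rewrite PuPhi sub0r; have [_ _ hs] := hB j; apply: le_trans (hs _) _.
    apply: le_trans (N0' j); rewrite ler_wpM2l// (le_trans (Pu_le _))//.
    by rewrite enormN.
  rewrite PsPhi XE mulmx0 add0r; apply: le_trans (Ps_le _) _.
  by have := N0 (ord_pred j); rewrite ord_predK.
have q01 : 0 <= q < 1 by rewrite q0.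
have [w [wb wfix]] := weighted_fixpoint nrm_enorm nrmD rho0 q01 ctr H0.
exists w; split => [j|j]; first exact: wball.
(* The stable half of the orbit equation is the fixed point equation at [ordS j]; the unstable half
   is the one at [j], after applying [A j] to cancel [B j]. *)
rewrite -XE -(subrK (Pu *m w (ordS j)) (w (ordS j))).
rewrite -{1 2}(wfix (ordS j)) PsPhi ordSK.
have [hc hi _] := hB j.
suff -> : Pu *m w (ordS j) = Pu *m X w j by rewrite subrK.
have : A j *m (Pu *m w j) = Pu *m (w (ordS j) - N j (w j)).
  by rewrite -[in LHS](wfix j) PuPhi !mulmxA hi.
rewrite mulmxA A_comm mulmxBr -mulmxA XE mulmxDr => ->.
by rewrite subrK.
Qed.

(** At an index where [nrm (v j)] is largest, the stable part seen from the predecessor and the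
    unstable part seen from the successor are both at most [sigma + 2 * theta] times this maximum.
    The phases [a j] preserve norms. *)
Lemma cyclic_linear_orbit_eq0 (D : 'I_m -> 'M[R[i]]_k) (a : 'I_m -> R[i])
    (v : 'I_m -> Ck) :
  sigma + 2 * theta < 1 ->
  (forall j x, enorm (D j *m x - A j *m x) <= theta * enorm x) ->
  (forall j, Normc.normc (a j) = 1) ->
  (forall j, a j *: v (ordS j) = D j *m v j) ->
  forall j, v j = 0.
Proof.
move=> q1 DA a1 vD j0; have /andP[s0 s1] := sigma01.
have [i _ hi] := @arg_maxP _ _ _ j0 xpredT (fun j => nrm (v j)) isT.
have [M ME] : exists M, M = nrm (v i) by exists (nrm (v i)).
have {}hi j : nrm (v j) <= M by rewrite ME; exact: hi.
have M0 : 0 <= M by rewrite ME (le_trans _ (u_le _)).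
have bD j : enorm (D j *m v j - A j *m v j) <= 2 * theta * M.
  apply: (le_trans (DA j (v j))).
  rewrite [2 * theta]mulrC -mulrA.
  apply: ler_wpM2l => //.
  apply: le_trans (n_le _) _.
  have h2 : 0 < 2 :> R by [].
  rewrite (ler_pM2l h2).
  exact: hi.
have vE j : nrm (v j) <= (sigma + 2 * theta) * M.
  rewrite ge_max; apply/andP; split.
    apply: le_trans (A_unstable j _) _; rewrite mulmxA A_comm -mulmxA.
    apply: (@le_trans _ _ (sigma * (M + 2 * theta * M))).
      rewrite ler_wpM2l//.
      have -> : Pu *m (A j *m v j) = Pu *m (D j *m v j) - Pu *m (D j *m v j - A j *m v j).
        by rewrite [in RHS](mulmxBr Pu) subKr.
      apply: le_trans (enormB _ _) _; apply: lerD; last exact: le_trans (Pu_le _) (bD j).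
      rewrite -vD -scalemxAr enormZ a1 mul1r; apply: le_trans (u_le _) _; exact: hi.
    have : sigma * (2 * theta * M) <= 1 * (2 * theta * M).
      by rewrite ler_wpM2r// !mulr_ge0.
    by lra.
  set l := ord_pred j.
  have -> : enorm (v j - Pu *m v j) = enorm (D l *m v l - Pu *m (D l *m v l)).
    by rewrite -vD /l ord_predK -scalemxAr -scalerBr enormZ a1 mul1r.
  have -> : D l *m v l - Pu *m (D l *m v l) = A l *m (v l - Pu *m v l) +
     ((D l *m v l - A l *m v l) - Pu *m (D l *m v l - A l *m v l)).
    rewrite !mulmxBr (mulmxA (A l)) A_comm -(mulmxA Pu (A l)).
    move: (Pu *m (D l *m v l)) (Pu *m (A l *m v l)) (D l *m v l) (A l *m v l) => y1 y2 y3 y4.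
    by apply/colP => b; rewrite !mxE; ring.
  apply: le_trans (enormD _ _) _; rewrite mulrDl; apply: lerD.
    apply: le_trans (A_stable _ _) _; rewrite ler_wpM2l//.
    exact: le_trans (s_le _) (hi _).
  exact: le_trans (Ps_le _) (bD l).
have M00 : M = 0.
  apply/eqP; rewrite eq_le M0 andbT; have := vE i; rewrite -ME => h.
  rewrite leNgt; apply/negP => Mgt; move: h; rewrite leNgt.
  by rewrite -[X in _ < X]mul1r ltr_pM2r// q1.
apply: enorm0_eq0; apply/eqP; rewrite eq_le enorm_ge0 andbT.
apply: le_trans (n_le _) _; rewrite pmulr_rle0// -M00; exact: hi.
Qed.

End CyclicHyperbolic.

(** * Charts and compactness *)

(** [P] is asked for every [b >= b0] so that local bounds merge along the filter at [+oo]. Applied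
    with [b^-1] as a radius, it also gives uniform smallness. *)
Lemma compact_uniform {R : realType} (T : topologicalType) (K : set T)
    (P : R -> T -> Prop) : compact K ->
  (forall x, K x -> exists b0, nbhs x [set y | forall b, b0 <= b -> P b y]) ->
  exists2 b, 0 < b & forall y, K y -> P b y.
Proof.
move=> /compact_near_coveringP cK loc.
have := cK R (+oo)%R P _ _; case.
  move=> x /loc[b0 hb]; exists ([set y | forall b, b0 <= b -> P b y], [set b | b0 <= b]).
    by split => //; apply: nbhs_pinfty_ge; exact: num_real.
  by move=> [y b] [] /= h hb'; exact: h.
move=> b [_ hb]; exists (Num.max (b + 1) 1); first by rewrite lt_max ltr01 orbT.
by apply: hb; rewrite lt_max ltrDl ltr01.
Qed.

Section ManifoldCharts.
Context {R : realType} {k : nat} {X : pmetricType R}.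
Local Notation Ck := 'cV[R[i]]_k.
Variables (M : complex_manifold k X) (T : chart_family k X).
Variable mu : probability (borel X) R.
Hypothesis goodT : good_charts M T mu.

Lemma nbhs_mdist (x : X) (A : set X) :
  nbhs x A <-> exists2 e : R, 0 < e & forall y, mdist x y < e -> A y.
Proof.
split=> [/nbhs_ballP|] [e e0 h]; [|apply/nbhs_ballP]; exists e => //.
  by move=> y xy; apply: h; rewrite ballEmdist.
by move=> y; rewrite ballEmdist; exact: h.
Qed.

Lemma tbase_coord (x : X) : tbase T x = Defs.coord (psi (tidx T x)) x.
Proof.
have h0 : enorm (0 : Ck) < tradius T by rewrite enorm0 (tau_radius goodT).
have := tau_domain goodT x h0; rewrite addr0 => cd.
have [[_ _ cp _ _] _] := psi_holomorphic goodT (tidx T x).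
by rewrite -[LHS](cp _ cd); have := tau_center goodT x; rewrite /tau addr0 => ->.
Qed.

Lemma psi_tidx_img (x : X) : cimg (psi (tidx T x)) x.
Proof.
have h0 : enorm (0 : Ck) < tradius T by rewrite enorm0 (tau_radius goodT).
have := tau_domain goodT x h0; rewrite addr0 => cd.
by exists (tbase T x) => //; have := tau_center goodT x; rewrite /tau addr0.
Qed.

Lemma tau_continuous x w (A : set X) : enorm w < tradius T ->
  nbhs (tau T x w) A ->
  exists2 rho : R, 0 < rho & forall w', enorm (w' - w) < rho -> A (tau T x w').
Proof.
move=> wr nA; have [[_ _ _ cont _] _] := psi_holomorphic goodT (tidx T x).
have := cont _ (tau_domain goodT x wr) A nA.
move=> /nbhs_enorm[rho rho0 h]; exists rho => // w' ww'; apply: h.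
by rewrite opprD addrACA subrr add0r.
Qed.

(** The distance is controlled in atlas charts, and the derivative of [tau] is bounded when read in
    such a chart. Near each point of [X] the two are combined; compactness gives a common [K]. *)
Lemma tau_locally_lipschitz : compact [set: X] ->
  exists2 K : R, 0 < K & forall x w, enorm w < tradius T ->
  exists2 rho : R, 0 < rho & forall w', enorm (w' - w) < rho ->
    mdist (tau T x w) (tau T x w') <= K * enorm (w' - w).
Proof.
move=> cX.
pose P (K : R) (y : X) := forall x w, enorm w < tradius T -> tau T x w = y ->
  exists2 rho : R, 0 < rho & forall w', enorm (w' - w) < rho ->
    mdist (tau T x w) (tau T x w') <= K * enorm (w' - w).
suff [K K0 h] : exists2 K, 0 < K & forall y, setT y -> P K y.
  by exists K => // x w wr; exact: (h (tau T x w)).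
apply: compact_uniform => // p _.
have [c ac cp] := atlas_cover M p.
have [_ oimg _ _ ccont] := atlas_chart ac.
have [W [B [Wp HW]]] := tau_bounded goodT ac cp.
have parc y : cimg c y -> par c (Defs.coord c y) = y.
  have [_ _ cK _ _] := atlas_chart ac.
  by move=> [u cu <-]; rewrite cK.
have cdp : cdom c (Defs.coord c p).
  have [_ _ cK _ _] := atlas_chart ac.
  by case: cp => u cu <-; rewrite cK.
have [L [rho [L0 rho0 HL]]] := atlas_dist ac cdp.
have rho2 : 0 < rho / 2 by rewrite divr_gt0.
(* [L] compares the distance with the chart, [B] bounds the derivative of [tau] and comes without a
   sign, and [+ 1] absorbs the first-order remainder. *)
exists (L * (`|B| + 1)).
have N1 : nbhs p (cimg c) by exact: open_nbhs_nbhs.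
have N2 : nbhs p [set y | enorm (Defs.coord c y - Defs.coord c p) < rho / 2].
  apply: (ccont p cp [set v | enorm (v - Defs.coord c p) < rho / 2]).
  by apply/nbhs_enorm; exists (rho / 2).
have [e1 e10 h1] := (nbhs_mdist p _).1 Wp.
have [e2 e20 h2] := (nbhs_mdist p _).1 N1.
have [e3 e30 h3] := (nbhs_mdist p _).1 N2.
apply: (iffRL (nbhs_mdist p _)).
exists (Num.min (Num.min e1 e2) e3) => [|y]; first by rewrite !lt_min e10 e20.
rewrite !lt_min => /andP[/andP[/h1 Wy /h2 cy] /h3/= ny] /= K hK x w wr txw.
subst y; have [[dtau dB] _] := HW x w wr Wy.
have B0 : 0 < `|B| + 1 by rewrite ltr_wpDl.
have jB v : enorm (jac (Defs.coord c \o tau T x) w *m v) <= `|B| * enorm v.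
  by rewrite jac_mulmx (le_trans (dB v))// ler_wpM2r// ler_norm.
have [r1 r10 H1] := hasD_lipschitz ltr01 (differentiable_hasD dtau) jB.
have N3 : nbhs (tau T x w) (cimg c) by exact: open_nbhs_nbhs.
have [r2 r20 H2] := tau_continuous wr N3.
exists (Num.min (Num.min r1 r2) (rho / 2 / (`|B| + 1))).
  by rewrite !lt_min r10 r20 divr_gt0.
move=> w'; rewrite !lt_min => /andP[/andP[/H1 {}H1 /H2 {}H2]].
rewrite ltr_pdivlMr// mulrC => wrho.
have near' : enorm (Defs.coord c (tau T x w') - Defs.coord c p) < rho.
  apply: le_lt_trans (enorm_dist _ (Defs.coord c (tau T x w)) _) _.
  by rewrite [rho]splitr ltrD// (le_lt_trans H1).
have near0 : enorm (Defs.coord c (tau T x w) - Defs.coord c p) < rho.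
  by apply: lt_trans ny _; rewrite ltr_pdivrMr// ltr_pMr// ltr1n.
have [] := HL _ _ near0 near'; rewrite !parc// => HL1 _.
apply: le_trans HL1 _; rewrite enorm_distC.
apply: le_trans (_ : L * ((`|B| + 1) * enorm (w' - w)) <= _).
  by rewrite ler_wpM2l// ltW.
by rewrite mulrA ler_wpM2r.
Qed.

(** The local estimate is integrated along the ray from [0] to [w] by [lipschitz_path], applied to
    the distance of [X] pulled back to [[0, 1]]. *)
Lemma tau_lipschitz : compact [set: X] ->
  exists2 K : R, 0 < K & forall x w, enorm w < tradius T ->
    mdist x (tau T x w) <= K * enorm w.
Proof.
move=> /tau_locally_lipschitz[K K0 H]; exists K => // x w wr.
pose d (s t : R) := mdist (tau T x (s%:C *: w)) (tau T x (t%:C *: w)).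
have -> : mdist x (tau T x w) = d 0 1.
  by rewrite /d scale0r scale1r (tau_center goodT).
apply: lipschitz_path.
- by move=> t; exact: mdistxx.
- by move=> r s t; exact: metric_triangle.
- by move=> s t; exact: metric_sym.
move=> t /andP[t0 t1].
have tw : enorm (t%:C *: w) < tradius T.
  by apply: le_lt_trans wr; rewrite enormZr ger0_norm// ler_piMl.
have [rho rho0 h] := H x _ tw.
have w1 : 0 < enorm w + 1 by rewrite ltr_wpDl.
exists (rho / (enorm w + 1)) => [|s _ st]; first by rewrite divr_gt0.
have sw : enorm (s%:C *: w - t%:C *: w) = `|s - t| * enorm w.
  by rewrite -scalerBl -rmorphB enormZr.
have := h (s%:C *: w); rewrite sw -mulrA [enorm w * _]mulrC; apply.
move: st; rewrite ltr_pdivlMr//; apply: le_lt_trans.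
by rewrite ler_wpM2l// lerDl.
Qed.

End ManifoldCharts.

Lemma nbhs_mulmx {R : realType} {k : nat} (A : 'M[R[i]]_k) (e : R) : 0 < e ->
  nbhs A [set B | forall v, enorm (B *m v - A *m v) <= e * enorm v].
Proof.
move=> e0; apply: (iffRL (@nbhs_normP _ 'M[R[i]]_k A _)).
have k0 : 0 < (k * k).+1%:R :> R by rewrite ltr0n.
exists (e / (k * k).+1%:R)%:C; first by rewrite /= ltcR divr_gt0.
move=> B /= BA v; rewrite -mulmxBl; set D := B - A.
have De a b : Normc.normc (D a b) <= e / (k * k).+1%:R.
  rewrite -lecR -normcE; apply: le_trans (ltW BA); rewrite distrC -/D.
  rewrite [leRHS]/Num.norm/= mx_normE -[leLHS]nngE num_le.
  by apply/bigmax_geP; right; exists (a, b); rewrite // lexx.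
apply: le_trans (enorm_le_sum _) _.
apply: (@le_trans _ _ (\sum_(a < k) \sum_(b < k) e / (k * k).+1%:R * enorm v)).
  apply: ler_sum => a _; rewrite mxE -lecR -normcE.
  apply: le_trans (ler_norm_sum _ _ _) _; rewrite rmorph_sum/=.
  apply: ler_sum => b _; rewrite normcE lecR Normc.normcM ler_pM ?normc_ge0//.
  exact: entry_le_enorm.
rewrite !sumr_const !card_ord -mulrnA -[leLHS]mulr_natr mulrAC ler_wpM2r//.
by rewrite mulrAC ler_pdivrMr// ler_wpM2l ?(ltW e0)// ler_nat.
Qed.

(** * Uniform estimates on a compact set of orbits *)

Section CompactOrbits.
Context {R : realType} {k : nat} {X : pmetricType R}.
Local Notation Ck := 'cV[R[i]]_k.
Local Notation hatX := {ptws int -> X}.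
Variables (f : X -> X) (I : set X) (dhat : hatX -> hatX -> R) (Lam : set hatX).
Hypothesis sm : standard_metric f I dhat.
Hypothesis Lam_compact : compact Lam.
Hypothesis Lam_sub : forall x, Lam x -> Omega_hat f I x.

Lemma within_dhat (x : hatX) (A : set hatX) : Lam x -> within Lam (nbhs x) A ->
  exists2 s : R, 0 < s & forall y, Lam y -> dhat x y < s -> A y.
Proof.
move=> Lx nA.
have [+ _] := dhat_topology sm [set y | Lam y -> A y] (Lam_sub Lx).
case=> [|s s0 h]; first by apply: (@filterS _ _ (nbhs_filter x) _ _ _ nA) => y h _.
by exists s => // y Ly xy; apply: h => //; exact: Lam_sub.
Qed.

(** A Lebesgue number argument, which turns continuity on the compact set into uniform
    continuity. *)
Lemma dhat_uniform (Q : hatX -> hatX -> Prop) :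
  (forall x, Lam x -> exists2 s : R, 0 < s & forall y z, Lam y -> Lam z ->
     dhat x y < s -> dhat x z < s -> Q y z) ->
  exists2 eta : R, 0 < eta & forall y z, Lam y -> Lam z -> dhat y z < eta -> Q y z.
Proof.
move=> loc.
pose P (b : R) (y : hatX) := forall z, Lam y -> Lam z -> dhat y z < b^-1 -> Q y z.
suff [b b0 h] : exists2 b, 0 < b & forall y, Lam y -> P b y.
  by exists b^-1; rewrite ?invr_gt0// => y z Ly Lz; exact: h.
apply: compact_uniform => // x Lx; have [s s0 h] := loc x Lx.
exists (2 / s).
have Ox := Lam_sub Lx.
have : within (Omega_hat f I) (nbhs x) [set y | dhat x y < s / 2].
  apply: (iffRL (dhat_topology sm [set y | dhat x y < s / 2] Ox)).
  by exists (s / 2) => //; rewrite divr_gt0.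
rewrite {1}/within/=.
apply: (@filterS _ _ (nbhs_filter x)) => y hy /= b sb z Ly Lz yz; have {}hy := hy (Lam_sub Ly).
have b0 : 0 < b by apply: lt_le_trans sb; rewrite divr_gt0.
have bs : b^-1 <= s / 2.
  by rewrite -[s / 2]invrK lef_pV2 ?posrE ?invr_gt0 ?divr_gt0// invf_div.
have s2 : s / 2 < s by rewrite ltr_pdivrMr// ltr_pMr// ltr1n.
apply: h => //; first exact: lt_trans hy s2.
apply: le_lt_trans (dhat_triangle sm Ox (Lam_sub Ly) (Lam_sub Lz)) _.
by rewrite [s]splitr ltrD// (lt_le_trans yz).
Qed.

Lemma within_matrix_uniform (C : hatX -> 'M[R[i]]_k) (e : R) : 0 < e ->
  {within Lam, continuous C} ->
  exists2 eta : R, 0 < eta & forall y z, Lam y -> Lam z -> dhat y z < eta ->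
    forall v, enorm (C z *m v - C y *m v) <= e * enorm v.
Proof.
move=> e0 /subspace_continuousP cC.
apply: dhat_uniform => x Lx.
have e2 : 0 < e / 2 by rewrite divr_gt0.
have [s s0 h] := within_dhat Lx (cC x Lx _ (nbhs_mulmx (C x) e2)).
exists s => // y z Ly Lz xy xz v.
apply: le_trans (enorm_dist _ (C x *m v) _) _.
rewrite [e]splitr mulrDl; apply: lerD; first exact: h z Lz xz v.
by rewrite enorm_distC; exact: h y Ly xy v.
Qed.

Lemma within_matrix_bounded (C : hatX -> 'M[R[i]]_k) :
  {within Lam, continuous C} ->
  exists2 c : R, 0 < c & forall y, Lam y -> forall v, enorm (C y *m v) <= c * enorm v.
Proof.
move=> /subspace_continuousP cC.
pose P (b : R) (y : hatX) := Lam y -> forall v, enorm (C y *m v) <= b * enorm v.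
suff [b b0 h] : exists2 b, 0 < b & forall y, Lam y -> P b y.
  by exists b => // y Ly; exact: h.
apply: compact_uniform => // x Lx.
have [B B0 hB] := enorm_mulmx_bound (C x).
exists (1 + B); have Hx := cC x Lx _ (nbhs_mulmx (C x) ltr01).
apply: (@filterS _ _ (nbhs_filter x) _ _ _ Hx) => y hy /= b Bb Ly v.
rewrite -(subrK (C x *m v) (C y *m v)) (le_trans (enormD _ _))//.
apply: (@le_trans _ _ (1 * enorm v + B * enorm v)); first by apply: lerD; [exact: hy Ly v|exact: hB].
by rewrite -mulrDl ler_wpM2r.
Qed.

Lemma within_inv_bounded (a : hatX -> R) : (forall y, Lam y -> 0 < a y) ->
  {within Lam, continuous (fun y => (a y)^-1 : R)} ->
  exists2 c : R, 0 < c & forall y, Lam y -> a y <= c.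
Proof.
move=> apos /subspace_continuousP ca.
pose P (b : R) (y : hatX) := Lam y -> a y <= b.
suff [b b0 h] : exists2 b, 0 < b & forall y, Lam y -> P b y.
  by exists b => // y Ly; exact: h.
apply: compact_uniform => // x Lx; exists (2 * a x).
have ax := apos _ Lx.
have lt2 : (2 * a x)^-1 < (a x)^-1.
  by rewrite ltf_pV2 ?posrE ?mulr_gt0// ltr_pMl// ltr1n.
have nb : nbhs (a x)^-1 [set t : R | (2 * a x)^-1 <= t].
  exact: (cvgr_ge _ (@cvg_id _ (nbhs (a x)^-1)) _ lt2).
have Hx := ca x Lx _ nb.
apply: (@filterS _ _ (nbhs_filter x) _ _ _ Hx) => y hy /= b Bb Ly; have {}hy := hy Ly.
apply: le_trans Bb; move: hy => /=.
by rewrite lef_pV2 ?posrE ?apos// mulr_gt0.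
Qed.

Context {M : complex_manifold k X} {T : chart_family k X}.
Context {mu : probability (borel X) R}.
Hypothesis goodT : good_charts M T mu.

(** Within one chart the base point is the coordinate of the point, hence continuous. A change of
    chart could make it jump, which the last hypothesis excludes for close points. *)
Lemma tbase_uniform (eps0 e : R) : 0 < eps0 -> 0 < e ->
  (forall y z, Lam y -> Lam z -> mdist (y 0) (z 0) < eps0 ->
     tidx T (y 0) = tidx T (z 0)) ->
  exists2 eta : R, 0 < eta & forall y z, Lam y -> Lam z -> dhat y z < eta ->
    enorm (tbase T (z 0) - tbase T (y 0)) <= e.
Proof.
move=> ep0 e0 same; apply: dhat_uniform => x Lx.
have [[_ _ _ _ cc] _] := psi_holomorphic goodT (tidx T (x 0)).
have e2 : 0 < e / 2 by rewrite divr_gt0.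
have /nbhs_mdist[s s0 h] : nbhs (x 0) [set y | enorm
    (Defs.coord (psi (tidx T (x 0))) y - tbase T (x 0)) <= e / 2].
  rewrite (tbase_coord goodT (x 0)).
  apply: (cc _ (psi_tidx_img goodT (x 0)) [set v |
    enorm (v - Defs.coord (psi (tidx T (x 0))) (x 0)) <= e / 2]).
  by apply/nbhs_enorm; exists (e / 2) => // v /ltW.
exists (Num.min s eps0) => [|y z Ly Lz]; first by rewrite lt_min s0.
have P1 t : Lam t -> dhat x t < Num.min s eps0 ->
    enorm (tbase T (t 0) - tbase T (x 0)) <= e / 2.
  move=> Lt; rewrite lt_min => /andP[ts te].
  have d := dhat_proj sm (Lam_sub Lx) (Lam_sub Lt).
  rewrite (tbase_coord goodT (t 0)) -(same x t)//; last exact: le_lt_trans te.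
  exact: h (le_lt_trans d ts).
move=> xy xz; apply: le_trans (enorm_dist _ (tbase T (x 0)) _) _.
by rewrite [e]splitr lerD ?P1// enorm_distC P1.
Qed.

End CompactOrbits.

(** * Pesin charts *)

Section PesinCharts.
Context {R : realType} {k : nat} {X : pmetricType R}.
Local Notation Ck := 'cV[R[i]]_k.
Local Notation hatX := {ptws int -> X}.
Local Notation fhat := (@shiftZ R X 1).

Lemma shiftZ0 (x : hatX) : shiftZ 0 x = x.
Proof. by apply/funext => j; rewrite /shiftZ addr0. Qed.

Lemma shiftZS (n : nat) (x : hatX) : fhat (shiftZ n%:Z x) = shiftZ n.+1%:Z x.
Proof. by apply/funext => j; rewrite /shiftZ -addrA intS. Qed.

Lemma shiftZ_invariant (G : set hatX) (x : hatX) (n : nat) :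
  (forall x, G (fhat x) <-> G x) -> G x -> G (shiftZ n%:Z x).
Proof.
move=> GS Gx; elim: n => [|n ih]; first by rewrite shiftZ0.
by rewrite -shiftZS; apply/GS.
Qed.

Context {f : X -> X} {I : set X} {T : chart_family k X} {M : complex_manifold k X}.
Context {mu : probability (borel X) R}.
Variables (C : hatX -> 'M[R[i]]_k) (eps1 K p : R) (Gam : set hatX).
Hypothesis k_gt0 : (0 < k)%N.
Hypothesis openI : open (~` I).
Hypothesis goodT : good_charts M T mu.
Hypothesis holo : holomorphy_constants f I T C eps1 K p Gam.
Hypothesis Gam_sub : Gam `<=` Omega_hat f I.
Hypothesis Gam_shift : forall x, Gam (fhat x) <-> Gam x.
Hypothesis C_unit : forall x, Gam x -> C x \in unitmx.

Lemma dist_to_gt0 (x : X) : ~ I x -> 0 < dist_to I x.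
Proof.
move=> nIx; rewrite /dist_to; case: asboolP => // -[z Iz].
have [e e0 he] := (nbhs_mdist x (~` I)).1 (open_nbhs_nbhs (conj openI nIx)).
apply: lt_le_trans e0 _; apply: lb_le_inf; first by exists (mdist x z); exists z.
move=> _ [t It <-]; rewrite leNgt; apply/negP => /he; exact.
Qed.

Lemma Omega_hat_step (x : hatX) : Omega_hat f I x -> f (x 0) = fhat x 0.
Proof. by move=> /(_ 0)[_ ->]; rewrite /shiftZ addrC. Qed.

Variables (y : hatX) (a : R).
Hypothesis Gy : Gam y.
Hypothesis alpha_a : Defs.alpha I C eps1 K p y <= a.

(** The second entry of the maximum defining [alpha] is the inverse of the radius of holomorphy. *)
Lemma pesin_radius (w : Ck) : enorm w <= a^-1 ->
  enorm w <= eps1 * dist_to I (y 0) `^ p / opnorm (C y).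
Proof.
have [e0 K0 p0 _] := holo.
have nI : ~ I (y 0) by have [/(_ 0%N)] := Gam_sub Gy 0.
have d0 : 0 < eps1 * dist_to I (y 0) `^ p.
  by rewrite mulr_gt0// powR_gt0// dist_to_gt0.
have o0 : 0 < opnorm (C y) by rewrite opnorm_gt0 ?C_unit.
move=> /le_trans; apply; rewrite -invf_div lef_pV2.
- by apply: le_trans alpha_a; rewrite /Defs.alpha le_max le_max lexx orbT.
- by rewrite posrE (lt_le_trans _ alpha_a)// /Defs.alpha lt_max ltr01.
- by rewrite posrE divr_gt0.
Qed.

Lemma gloc_D2 (w : Ck) : enorm w <= a^-1 ->
  differentiable (gloc f T C y) w /\ norm_D2_le (gloc f T C y) w a.
Proof.
move=> wa; have [_ _ _ /(_ y w Gy (pesin_radius wa))[_ dg [D1 D2]]] := holo.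
split=> //; split=> // u v; apply: le_trans (D2 u v) _.
rewrite ler_wpM2r// ler_wpM2r//; apply: le_trans alpha_a.
by rewrite /Defs.alpha !le_max lexx !orbT.
Qed.

Lemma gloc_conj (w : Ck) : enorm w <= a^-1 ->
  [/\ ~ I (tau T (y 0) (C y *m w)), enorm (C y *m w) < tradius T,
      enorm (C (fhat y) *m gloc f T C y w) < tradius T &
      f (tau T (y 0) (C y *m w)) = tau T (fhat y 0) (C (fhat y) *m gloc f T C y w)].
Proof.
move=> wa; have [_ _ _ /(_ y w Gy (pesin_radius wa))[fd _ _]] := holo.
have [wT nI [v vT fv]] := fd; rewrite -(Omega_hat_step (Gam_sub Gy)).
have uC : C (fhat y) \in unitmx by apply: C_unit; apply/Gam_shift.
(* The [v] provided by [floc_dom] lies where [coord] inverts [par]; there the local map represents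
   [f] faithfully. *)
have -> : C (fhat y) *m gloc f T C y w = v.
  rewrite /gloc /Cinv mulKVmx// /floc /= fv /tau_inv /tau.
  have [[_ _ cK _ _] _] := psi_holomorphic goodT (tidx T (f (y 0))).
  by rewrite (cK _ (tau_domain goodT (f (y 0)) vT)) addrC addKr.
by split.
Qed.

Lemma gloc0 : gloc f T C y 0 = 0.
Proof.
rewrite /gloc mulmx0 /floc /= (tau_center goodT) /tau_inv.
by rewrite -(tbase_coord goodT) subrr mulmx0.
Qed.

Lemma jac_gloc0 : jac (gloc f T C y) 0 = Agamma f T C y.
Proof.
have e0 : enorm (0 : Ck) <= a^-1.
  by rewrite enorm0 invr_ge0 (le_trans _ alpha_a)// /Defs.alpha le_max ler01.
have uC : C y \in unitmx by exact: C_unit.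
have uC' : C (fhat y) \in unitmx by apply: C_unit; apply/Gam_shift.
(* The derivative of [floc] at [0] is recovered from that of [gloc] by undoing the conjugation with
   [C]. *)
have := differentiable_hasD (gloc_D2 e0).1.
move: (jac (gloc f T C y) 0) => J Jg.
have h1 : hasD (fun v : Ck => 0 + invmx (C y) *m v) 0 (invmx (C y)).
  exact: hasD_affine.
have Jg' : hasD (gloc f T C y) (0 + invmx (C y) *m 0) J by rewrite mulmx0 addr0.
have h2 : hasD (fun v : Ck => 0 + C (fhat y) *m v)
  ((gloc f T C y \o (fun v : Ck => 0 + invmx (C y) *m v)) 0) (C (fhat y)).
  exact: hasD_affine.
have := hasD_comp (hasD_comp h1 Jg') h2.
rewrite (_ : _ \o _ = floc f T (y 0)); last first.
  apply/funext => v /=; rewrite !add0r /gloc /Cinv mulKVmx//.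
  by rewrite mulKVmx.
move=> /hasD_diff[_ cE]; rewrite /Agamma /cocycle /Cinv cE.
by rewrite !mulmxA mulVmx// mul1mx -mulmxA mulVmx// mulmx1.
Qed.

End PesinCharts.

(** * Block diagonal matrices *)

Section CoordinateProjection.
Context {R : realType} {k : nat}.
Local Notation Ck := 'cV[R[i]]_k.

Definition proj_mx_on (U : pred 'I_k) : 'M[R[i]]_k := diag_mx (\row_a (U a)%:R).

Lemma proj_mx_onE U (v : Ck) a :
  (proj_mx_on U *m v) a 0 = if U a then v a 0 else 0.
Proof. by rewrite mul_diag_mx !mxE; case: (U a); rewrite ?mul1r ?mul0r. Qed.

Lemma proj_mx_on_compE U (v : Ck) a :
  (v - proj_mx_on U *m v) a 0 = if U a then 0 else v a 0.
Proof.
have E (w : Ck) : (v - w) a 0 = v a 0 - w a 0 by rewrite !mxE.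
by rewrite E proj_mx_onE; case: (U a); rewrite ?subrr ?subr0.
Qed.

Lemma proj_mx_on_idem U : proj_mx_on U *m proj_mx_on U = proj_mx_on U.
Proof.
apply/matrixP => a b; rewrite mul_diag_mx !mxE.
by case: (U a); rewrite ?mul1r ?mul0r ?mul0rn.
Qed.

Lemma enorm_le_entries (u v : Ck) :
  (forall a, Normc.normc (u a 0) <= Normc.normc (v a 0)) -> enorm u <= enorm v.
Proof.
move=> h; apply: enorm_le_sqr => //; rewrite enorm_sqr; apply: ler_sum => a _.
by rewrite ler_pXn2r ?nnegrE ?normc_ge0.
Qed.

Lemma proj_mx_on_le U (v : Ck) : enorm (proj_mx_on U *m v) <= enorm v.
Proof.
apply: enorm_le_entries => a; rewrite proj_mx_onE; case: ifP => // _.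
by rewrite Normc.normc0 normc_ge0.
Qed.

Lemma proj_mx_on_comp_le U (v : Ck) : enorm (v - proj_mx_on U *m v) <= enorm v.
Proof.
apply: enorm_le_entries => a; rewrite proj_mx_on_compE; case: ifP => // _.
by rewrite Normc.normc0 normc_ge0.
Qed.

Lemma proj_mx_on_comm U (A : 'M[R[i]]_k) :
  (forall a b, U a != U b -> A a b = 0) ->
  A *m proj_mx_on U = proj_mx_on U *m A.
Proof.
move=> h; apply/matrixP => a b; rewrite mul_diag_mx mul_mx_diag !mxE.
have [E|/h->] := eqVneq (U a) (U b); last by rewrite mulr0 mul0r.
by rewrite E mulrC.
Qed.

End CoordinateProjection.

Section BlockDiagonal.
Context {R : realType} {k l : nat}.
Local Notation Ck := 'cV[R[i]]_k.
Variables (chi : 'I_k -> \bar R) (lambda : 'I_l -> \bar R) (mult : 'I_l -> nat).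
Hypothesis mults : exponents_with_multiplicity chi lambda mult.

Let Pb (i : 'I_l) : 'M[R[i]]_k := proj_mx_on (fun a => chi a == lambda i).

Lemma in_block_proj i (v : Ck) : in_block chi lambda i (Pb i *m v).
Proof. by move=> a /negbTE h; rewrite proj_mx_onE h. Qed.

Lemma lambda_inj : injective lambda.
Proof.
move=> i j ij; apply/val_inj => /=; case: (ltngtP i j) => // h.
  by have := lambda_dec mults h; rewrite ij ltxx.
by have := lambda_dec mults h; rewrite ij ltxx.
Qed.

Lemma lambda_is_chi i : exists a, chi a = lambda i.
Proof.
have : (0 < #|[set a | chi a == lambda i]%SET|)%N.
  by rewrite (chi_mult mults) (mult_gt0 mults).
by rewrite card_gt0 => /set0Pn[a]; rewrite inE => /eqP ai; exists a.
Qed.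

(** Pythagoras: estimates on the blocks pass to the whole space with the same constant, so the rate
    [4 * gamma] is not weakened. *)
Lemma enorm_blocks (v : Ck) : enorm v ^+ 2 = \sum_(i < l) enorm (Pb i *m v) ^+ 2.
Proof.
under eq_bigr do rewrite enorm_sqr.
rewrite exchange_big enorm_sqr /=; apply: eq_bigr => a _.
have [i ai] := chi_lambda mults a.
rewrite (bigD1 i)//= proj_mx_onE ai eqxx big1 ?addr0// => j ji.
rewrite proj_mx_onE ai; case: eqP => [/lambda_inj ij|_].
  by rewrite ij eqxx in ji.
by rewrite Normc.normc0 expr0n.
Qed.

Variable A : 'M[R[i]]_k.
Hypothesis A_diag : forall a b, chi a != chi b -> A a b = 0.

Lemma block_comm i (v : Ck) : A *m (Pb i *m v) = Pb i *m (A *m v).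
Proof.
rewrite !mulmxA proj_mx_on_comm// => a b; have [E|/A_diag//] := eqVneq (chi a) (chi b).
by rewrite E eqxx.
Qed.

Lemma block_upper (c : R) (v : Ck) : 0 <= c ->
  (forall i, enorm (A *m (Pb i *m v)) <= c * enorm (Pb i *m v)) ->
  enorm (A *m v) <= c * enorm v.
Proof.
move=> c0 h; apply: enorm_le_sqr; first by rewrite mulr_ge0.
rewrite -enorm_sqr exprMn !enorm_blocks mulr_sumr; apply: ler_sum => i _.
by rewrite -block_comm -exprMn ler_pXn2r ?nnegrE ?mulr_ge0.
Qed.

Lemma block_lower (c : R) (v : Ck) : 0 <= c ->
  (forall i, enorm (Pb i *m v) <= c * enorm (A *m (Pb i *m v))) ->
  enorm v <= c * enorm (A *m v).
Proof.
move=> c0 h; apply: enorm_le_sqr; first by rewrite mulr_ge0.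
rewrite -enorm_sqr exprMn !enorm_blocks mulr_sumr; apply: ler_sum => i _.
by rewrite -block_comm -exprMn ler_pXn2r ?nnegrE ?mulr_ge0.
Qed.

Variable gamma : R.
Hypothesis gamma0 : 0 < gamma.
Hypothesis chi_lty : forall a, (chi a < +oo)%E.
Hypothesis chi_neq0 : forall a, chi a != 0%E.
Hypothesis gamma_chi : forall a, chi a != -oo%E -> 5 * gamma <= `|fine (chi a)|.
Hypothesis A_finite : forall i v, lambda i != -oo%E -> in_block chi lambda i v ->
    expR (fine (lambda i) - gamma) * enorm v <= enorm (A *m v)
      <= expR (fine (lambda i) + gamma) * enorm v.
Hypothesis A_infinite : forall i v, lambda i = -oo%E -> in_block chi lambda i v ->
    enorm (A *m v) <= expR (- (4 * gamma)) * enorm v.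

Let U : pred 'I_k := fun a => (0 < chi a)%E.
Let Pu : 'M[R[i]]_k := proj_mx_on U.

Lemma unstable_comm : A *m Pu = Pu *m A.
Proof.
apply: proj_mx_on_comm => a b; rewrite /U; have [->|/A_diag//] := eqVneq (chi a) (chi b).
by rewrite eqxx.
Qed.

Let fin_chi a : chi a != -oo%E -> chi a = (fine (chi a))%:E.
Proof.
by move=> h; rewrite fineK// fin_numE h lt_eqF.
Qed.

(** [gamma_chi] leaves the rate [4 * gamma] after the loss of [gamma] in the Pesin reduction. On
    blocks with nonpositive exponent [Pu *m v] vanishes. *)
Lemma unstable_expansion (v : Ck) :
  enorm (Pu *m v) <= expR (- (4 * gamma)) * enorm (A *m (Pu *m v)).
Proof.
apply: block_lower => [|i]; first exact: expR_ge0.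
have [a ai] := lambda_is_chi i.
have [lpos|lneg] := boolP (0 < lambda i)%E; last first.
  suff -> : Pb i *m (Pu *m v) = 0 by rewrite mulmx0 enorm0 mulr0.
  apply/colP => b; rewrite !proj_mx_onE mxE /U; case: eqP => // ->.
  by rewrite (negbTE lneg).
have linf : lambda i != -oo%E by rewrite gt_eqF// (lt_trans _ lpos).
have /andP[h _] := A_finite linf (@in_block_proj i (Pu *m v)).
rewrite expRN ler_pdivlMl ?expR_gt0//; apply: le_trans h.
rewrite ler_wpM2r// ler_expR -ai.
have cinf : chi a != -oo%E by rewrite ai.
have := gamma_chi cinf; move: lpos; rewrite -ai (fin_chi cinf) lte_fin /= => l0.
by rewrite (ger0_norm (ltW l0)); lra.
Qed.

Lemma stable_contraction (v : Ck) :
  enorm (A *m (v - Pu *m v)) <= expR (- (4 * gamma)) * enorm (v - Pu *m v).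
Proof.
apply: block_upper => [|i]; first exact: expR_ge0.
have [a ai] := lambda_is_chi i.
have [lpos|lneg] := boolP (0 < lambda i)%E.
  suff -> : Pb i *m (v - Pu *m v) = 0 by rewrite mulmx0 enorm0 mulr0.
  apply/colP => b; rewrite proj_mx_onE proj_mx_on_compE [RHS]mxE /U; case: eqP => // ->.
  by rewrite lpos.
have [linf|linf] := eqVneq (lambda i) -oo%E.
  exact: A_infinite linf (@in_block_proj i _).
have /andP[_ h] := A_finite linf (@in_block_proj i (v - Pu *m v)).
apply: le_trans h _; rewrite ler_wpM2r// ler_expR -ai.
have cinf : chi a != -oo%E by rewrite ai.
have := gamma_chi cinf; have := chi_neq0 a; move: lneg.
rewrite -ai (fin_chi cinf) lte_fin eqe -leNgt /= => l0 ln0.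
by rewrite ler0_norm//; lra.
Qed.

(** The bound depends only on the exponents and [gamma], hence is common to all orbits. The summand
    [1] covers the exponent [-oo]. *)
Lemma block_bounded (v : Ck) :
  enorm (A *m v) <= (1 + \sum_(a < k) expR (fine (chi a) + gamma)) * enorm v.
Proof.
have S0 : 0 <= \sum_(a < k) expR (fine (chi a) + gamma).
  by apply: sumr_ge0 => a _; exact: expR_ge0.
apply: block_upper => [|i]; first by rewrite addr_ge0.
have [a ai] := lambda_is_chi i.
have [linf|linf] := eqVneq (lambda i) -oo%E.
  apply: le_trans (A_infinite linf (@in_block_proj i _)) _; rewrite ler_wpM2r//.
  apply: (@le_trans _ _ 1); last by rewrite lerDl.
  by rewrite -[leRHS]expR0 ler_expR; have := gamma0; lra.
have /andP[_ h] := A_finite linf (@in_block_proj i v).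
apply: le_trans h _; rewrite ler_wpM2r// -ai (bigD1 a)//=.
rewrite addrCA lerDl addr_ge0//.
by apply: sumr_ge0 => b _; exact: expR_ge0.
Qed.

End BlockDiagonal.

(** * Almost returning sequences *)

Section ShadowingWeights.
Context {R : realType}.
Variables (gamma c : R) (m : nat).
Hypotheses (gamma0 : 0 < gamma) (c0 : 0 < c).

(** Equal to [c] at both [0] and [m], so that it descends to the cycle. *)
Definition shadow_weight (n : nat) : R :=
  c * Num.max (expR (- (2 * gamma * n%:R))) (expR (- (2 * gamma * (m - n)%:R))).

Lemma shadow_weight_gt0 n : 0 < shadow_weight n.
Proof. by rewrite mulr_gt0// lt_max expR_gt0. Qed.

Lemma shadow_weight0 : shadow_weight 0 = c.
Proof.
rewrite /shadow_weight mulr0 oppr0 expR0 max_l ?mulr1//.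
by rewrite -[leRHS]expR0 ler_expR oppr_le0 !mulr_ge0// ltW.
Qed.

Lemma shadow_weightm : shadow_weight m = c.
Proof.
rewrite /shadow_weight subnn mulr0 oppr0 expR0 max_r ?mulr1//.
by rewrite -[leRHS]expR0 ler_expR oppr_le0 !mulr_ge0// ltW.
Qed.

Lemma shadow_weight_up n : (n < m)%N ->
  shadow_weight n <= expR (2 * gamma) * shadow_weight n.+1.
Proof.
move=> nm; rewrite /shadow_weight mulrCA ler_wpM2l ?(ltW c0)// -subnSK//.
rewrite maxr_pMr ?expR_ge0// -!expRD ge_max !le_max !ler_expR -!natr1.
apply/andP; split; apply/orP; [left; lra|right].
by have := gamma0; lra.
Qed.

Lemma shadow_weight_down n : (n < m)%N ->
  shadow_weight n.+1 <= expR (2 * gamma) * shadow_weight n.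
Proof.
move=> nm; rewrite /shadow_weight mulrCA ler_wpM2l ?(ltW c0)// -[(m - n)%N]subnSK//.
rewrite maxr_pMr ?expR_ge0// -!expRD ge_max !le_max !ler_expR -!natr1.
by apply/andP; split; apply/orP; [left|right]; have := gamma0; lra.
Qed.

(** On each branch of the maximum the bound on [a] from the same end is used; its growth [gamma]
    consumes half of the decay [2 * gamma]. *)
Lemma shadow_weight_tempered n (a a0 : R) : 0 <= a0 ->
  a <= a0 * expR (gamma * n%:R) -> a <= a0 * expR (gamma * (m - n)%:R) ->
  a * shadow_weight n <=
    a0 * c * Num.max (expR (- (gamma * n%:R))) (expR (- (gamma * (m - n)%:R))).
Proof.
move=> a00 h1 h2; rewrite /shadow_weight mulrCA.
have -> t : a0 * c * t = c * (a0 * t) by ring.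
rewrite ler_wpM2l ?(ltW c0)//.
have E (t B : R) : a <= a0 * expR (gamma * t) -> expR (- (gamma * t)) <= B ->
    a * expR (- (2 * gamma * t)) <= a0 * B.
  move=> ht hB; apply: le_trans (ler_wpM2r (expR_ge0 _) ht) _.
  rewrite -[leLHS]mulrA ler_wpM2l// -expRD; apply: le_trans hB.
  by rewrite ler_expR; lra.
have [_|_] := leP (expR (- (2 * gamma * n%:R))) (expR (- (2 * gamma * (m - n)%:R))).
  by apply: E => //; rewrite le_max lexx orbT.
by apply: E => //; rewrite le_max lexx.
Qed.

End ShadowingWeights.

Section AlmostReturn.
Context {R : realType} {k m : nat}.
Local Notation Ck := 'cV[R[i]]_k.
Variables (g : nat -> Ck -> Ck) (a : nat -> R) (A : nat -> 'M[R[i]]_k).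
Variables (Pu C0 Cm : 'M[R[i]]_k) (b : Ck).
Variables (gamma c a0 c0 beta kappa Abar theta1 : R).
Let sigma := expR (- (4 * gamma)).
Let tau := expR (2 * gamma).
(** [theta1] bounds the nonlinear remainder; the other term is the deviation of the seam from the
    identity times the Lipschitz constant of [g]. *)
Let theta := theta1 + c0 * kappa * (theta1 + Abar).
Let q := (sigma + 2 * theta) * tau.
Let rho := shadow_weight gamma c m.

Hypothesis m_gt0 : (0 < m)%N.
Hypothesis gamma0 : 0 < gamma.
Hypotheses (c_gt0 : 0 < c) (a0_gt0 : 0 < a0) (c0_gt0 : 0 < c0).
Hypotheses (kappa0 : 0 <= kappa) (Abar0 : 0 <= Abar) (theta10 : 0 <= theta1).
Hypothesis theta11 : theta1 < 1.
Hypothesis q1 : q < 1.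
Hypothesis c_small : 2 * (c * a0) <= theta1.
Hypothesis b_small : c0 * beta <= (1 - q) * c.

Hypothesis Pu_idem : Pu *m Pu = Pu.
Hypothesis Pu_le : forall v, enorm (Pu *m v) <= enorm v.
Hypothesis Ps_le : forall v, enorm (v - Pu *m v) <= enorm v.

Hypothesis g_D2 : forall n w, (n < m)%N -> enorm w <= (a n)^-1 ->
  differentiable (g n) w /\ norm_D2_le (g n) w (a n).
Hypothesis g0 : forall n, (n < m)%N -> g n 0 = 0.
Hypothesis g_jac : forall n, (n < m)%N -> jac (g n) 0 = A n.
Hypothesis a_gt0 : forall n, (n < m)%N -> 0 < a n.
Hypothesis a_up : forall n, (n < m)%N -> a n <= a0 * expR (gamma * n%:R).
Hypothesis a_down : forall n, (n < m)%N -> a n <= a0 * expR (gamma * (m - n)%:R).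
Hypothesis A_comm : forall n, (n < m)%N -> A n *m Pu = Pu *m A n.
Hypothesis A_stable : forall n v, (n < m)%N ->
  enorm (A n *m (v - Pu *m v)) <= sigma * enorm (v - Pu *m v).
Hypothesis A_unstable : forall n v, (n < m)%N ->
  enorm (Pu *m v) <= sigma * enorm (A n *m (Pu *m v)).
Hypothesis A_bounded : forall n v, (n < m)%N -> enorm (A n *m v) <= Abar * enorm v.
Hypothesis C0_unit : C0 \in unitmx.
Hypothesis C0_inv : forall v, enorm (invmx C0 *m v) <= c0 * enorm v.
Hypothesis C_close : forall v, enorm (Cm *m v - C0 *m v) <= kappa * enorm v.
Hypothesis b_le : enorm b <= beta.

(** This product is the Lipschitz constant of the remainder of [g n] on the ball of radius
    [2 * rho n]. As [theta1 < 1], it also keeps that ball strictly inside radius [(a n)^-1]. *)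
Lemma weight_radius n : (n < m)%N -> a n * (2 * rho n) <= theta1.
Proof.
move=> nm; apply: le_trans c_small; rewrite mulrCA ler_pM2l//.
apply: le_trans (shadow_weight_tempered c_gt0 (ltW a0_gt0) (a_up nm) (a_down nm)) _.
rewrite [a0 * c]mulrC -[leRHS]mulr1 ler_wpM2l ?mulr_ge0 ?(ltW c_gt0) ?(ltW a0_gt0)//.
have e1 (t : R) : 0 <= t -> expR (- t) <= 1.
  by move=> t0; rewrite -[leRHS]expR0 ler_expR oppr_le0.
by rewrite ge_max !e1// mulr_ge0// ltW.
Qed.

Lemma weight_lt_radius n : (n < m)%N -> 2 * rho n < (a n)^-1.
Proof.
move=> nm; have an := a_gt0 nm.
rewrite -(ltr_pM2l an) mulfV ?gt_eqF//.
exact: le_lt_trans (weight_radius nm) theta11.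
Qed.

Let extra0 : 0 <= c0 * kappa * (theta1 + Abar).
Proof. exact: mulr_ge0 (mulr_ge0 (ltW c0_gt0) kappa0) (addr_ge0 theta10 Abar0). Qed.

Let theta0 : 0 <= theta. Proof. exact: addr_ge0. Qed.

Let sigma01 : 0 <= sigma <= 1.
Proof. by rewrite expR_ge0/= -[leRHS]expR0 ler_expR oppr_le0 mulr_ge0// ltW. Qed.

Let tau1 : 1 <= tau.
Proof. by rewrite -[leLHS]expR0 ler_expR mulr_ge0// ltW. Qed.

Definition return_map (w : Ck) : Ck := invmx C0 *m (b + Cm *m w).

Lemma return_close v : enorm (invmx C0 *m (Cm *m v) - v) <= c0 * kappa * enorm v.
Proof.
have -> : invmx C0 *m (Cm *m v) - v = invmx C0 *m (Cm *m v - C0 *m v).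
  by rewrite mulmxBr mulKmx.
apply: le_trans (C0_inv _) _; rewrite -mulrA ler_wpM2l//; exact: ltW.
Qed.

(* The last step of the almost-periodic orbit is followed by the change of
   Pesin chart from the end point back to the starting point. *)
Let F (j : 'I_m) (w : Ck) : Ck :=
  if j.+1 == m then return_map (g j w) else g j w.

Let N (j : 'I_m) (w : Ck) : Ck := F j w - A j *m w.

Let rem_lip (j : 'I_m) w w' : enorm w <= 2 * rho j -> enorm w' <= 2 * rho j ->
  enorm ((g j w - A j *m w) - (g j w' - A j *m w')) <= theta1 * enorm (w - w').
Proof.
move=> wr wr'; have jm := ltn_ord j.
have aj := a_gt0 jm.
have D2 v : enorm v <= 2 * rho j -> differentiable (g j) v /\ norm_D2_le (g j) v (a j).
  by move=> vr; apply: g_D2 => //; rewrite (le_trans vr)// ltW// weight_lt_radius.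
have := remainder_lipschitz aj D2 wr wr'; rewrite (g_jac jm) => /le_trans; apply.
by rewrite ler_wpM2r// weight_radius.
Qed.

Let g_lip (j : 'I_m) w w' : enorm w <= 2 * rho j -> enorm w' <= 2 * rho j ->
  enorm (g j w - g j w') <= (theta1 + Abar) * enorm (w - w').
Proof.
move=> wr wr'.
have -> : g j w - g j w' = ((g j w - A j *m w) - (g j w' - A j *m w')) + A j *m (w - w').
  rewrite mulmxBr; move: (g j w) (g j w') (_ *m w) (_ *m w') => y1 y2 y3 y4.
  by apply/colP => i; rewrite !mxE; ring.
rewrite mulrDl (le_trans (enormD _ _))// lerD//; first exact: rem_lip.
exact: A_bounded.
Qed.

Let N_lip (j : 'I_m) w w' : enorm w <= 2 * rho j -> enorm w' <= 2 * rho j ->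
  enorm (N j w - N j w') <= theta * enorm (w - w').
Proof.
move=> wr wr'; rewrite /N /F; case: ifP => _; last first.
  apply: le_trans (rem_lip wr wr') _; by rewrite ler_wpM2r// lerDl.
have -> : return_map (g j w) - A j *m w - (return_map (g j w') - A j *m w') =
  ((g j w - A j *m w) - (g j w' - A j *m w')) +
  (invmx C0 *m (Cm *m (g j w - g j w')) - (g j w - g j w')).
  rewrite /return_map !(mulmxDr, mulmxN).
  move: (g j w) (g j w') (A j *m w) (A j *m w') => y1 y2 y3 y4.
  move: (_ *m b) (_ *m (Cm *m y1)) (_ *m (Cm *m y2)) => y5 y6 y7.
  by apply/colP => i; rewrite !mxE; ring.
apply: le_trans (enormD _ _) _; rewrite mulrDl; apply: lerD; first exact: rem_lip.
apply: le_trans (return_close _) _; rewrite -[leRHS]mulrA ler_wpM2l//.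
  by rewrite mulr_ge0// ltW.
exact: g_lip.
Qed.

Let N0 (j : 'I_m) : N j 0 = if j.+1 == m then invmx C0 *m b else 0.
Proof.
rewrite /N /F mulmx0 subr0 (g0 (ltn_ord j)); case: ifP => // _.
by rewrite /return_map mulmx0 addr0.
Qed.

Let rho_ordS (j : 'I_m) : rho (ordS j) = rho j.+1.
Proof.
have [jm|] := ltnP j.+1 m; first by rewrite /= modn_small.
rewrite leq_eqVlt ltnNge ltn_ord orbF => /eqP jm.
by rewrite /= -jm modnn /rho shadow_weight0// shadow_weightm.
Qed.

Lemma closing_orbit : exists W : nat -> Ck,
  [/\ forall n, (n < m)%N -> enorm (W n) <= 2 * rho n,
      forall n, W n.+1 = g n (W n) & W 0%N = return_map (W m)].
Proof.
have rho0 (j : 'I_m) : 0 < rho j by exact: shadow_weight_gt0.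
have bN (j : 'I_m) : enorm (N j 0) <= (1 - q) * rho (ordS j).
  rewrite N0; case: ifP => [/eqP jm|_].
    rewrite rho_ordS jm /rho shadow_weightm//; apply: le_trans b_small.
    by apply: le_trans (C0_inv _) _; rewrite ler_wpM2l// ltW.
  by rewrite enorm0 mulr_ge0 ?subr_ge0 ?ltW.
(* Passing from [rho (ordS j)] to [rho j] costs [tau], and [sigma * tau <= 1] pays for it. *)
have bN' (j : 'I_m) : sigma * enorm (N j 0) <= (1 - q) * rho j.
  have h := bN j; have /andP[s0 _] := sigma01.
  apply: le_trans (ler_wpM2l s0 h) _; rewrite mulrCA ler_wpM2l ?subr_ge0 ?(ltW q1)//.
  rewrite rho_ordS; apply: le_trans (ler_wpM2l s0 (shadow_weight_down gamma0 c_gt0 (ltn_ord j))) _.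
  rewrite mulrA -expRD ler_piMl ?(ltW (rho0 j))// -[leRHS]expR0 ler_expR.
  by have := gamma0; lra.
have [w [wr wF]] := @cyclic_orbit R k m Pu (fun j => A j) sigma theta
  Pu_idem Pu_le Ps_le sigma01 theta0 (fun j => A_comm (ltn_ord j))
  (fun j v => A_stable v (ltn_ord j)) (fun j v => A_unstable v (ltn_ord j))
  N (fun j => rho j) tau q tau1 erefl q1 rho0
  (fun j => eq_ind_r (fun t => rho j <= tau * t)
     (shadow_weight_up gamma0 c_gt0 (ltn_ord j)) (rho_ordS j))
  (fun j => eq_ind_r (fun t => t <= tau * rho j)
     (shadow_weight_down gamma0 c_gt0 (ltn_ord j)) (rho_ordS j))
  N_lip bN bN'.
have {}wF j : w (ordS j) = F j (w j) by rewrite wF /N addrC subrK.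
(* The cycle is unrolled: [W m] is the value before the seam, whereas [w] returns to its first term
   through [return_map]. Both agree for [n < m]. *)
pose W := fix W n := if n is n'.+1 then g n' (W n') else w (Ordinal m_gt0).
have Ww n (nm : (n < m)%N) : W n = w (Ordinal nm).
  elim: n nm => [|n ih] nm /=; first by congr w; apply: val_inj.
  have nm' := ltnW nm; rewrite (ih nm').
  have -> : Ordinal nm = ordS (Ordinal nm') by apply: val_inj => /=; rewrite modn_small.
  by rewrite wF /F /= ltn_eqF.
exists W; split=> [n nm||]; first by rewrite (Ww _ nm).
  by [].
have m1 : (m.-1 < m)%N by rewrite prednK.
have E : W m = g m.-1 (W m.-1) by rewrite -{1}(prednK m_gt0).
rewrite E (Ww _ m1) (Ww _ m_gt0).
have -> : Ordinal m_gt0 = ordS (Ordinal m1).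
  by apply: val_inj; rewrite /= prednK// modnn.
by rewrite wF /F /= prednK// eqxx.
Qed.

(** By the second derivative bound the derivatives along [W] stay [theta1]-close to [A]. The phase
    [s] is placed at the seam alone. *)
Lemma closing_orbit_hyperbolic (W v : nat -> Ck) (s : R[i]) :
  (forall n, (n < m)%N -> enorm (W n) <= 2 * rho n) ->
  (forall n, (n < m)%N -> v n.+1 = jac (g n) (W n) *m v n) ->
  Normc.normc s = 1 ->
  invmx C0 *m (Cm *m v m) = s *: v 0%N ->
  v 0%N = 0.
Proof.
move=> Wr vg s1 vm.
pose D (j : 'I_m) : 'M[R[i]]_k := if j.+1 == m
  then invmx C0 *m Cm *m jac (g j) (W j) else jac (g j) (W j).
have jA (j : 'I_m) x : enorm (jac (g j) (W j) *m x - A j *m x) <= theta1 * enorm x.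
  have jm := ltn_ord j; have aj := a_gt0 jm.
  have D2 u : enorm u <= 2 * rho j -> differentiable (g j) u /\ norm_D2_le (g j) u (a j).
    by move=> ur; apply: g_D2 => //; rewrite (le_trans ur)// ltW// weight_lt_radius.
  have := D2_lipschitz aj D2 x (Wr _ jm); rewrite (g_jac jm) => /le_trans; apply.
  rewrite ler_wpM2r//; apply: le_trans (weight_radius jm).
  by rewrite ler_wpM2l ?(ltW aj)// Wr.
have DA (j : 'I_m) x : enorm (D j *m x - A j *m x) <= theta * enorm x.
  rewrite /D; case: ifP => _; last first.
    apply: le_trans (jA _ _) _; by rewrite ler_wpM2r// lerDl.
  rewrite -!mulmxA; move: (jA j x); move: (jac _ _ *m x) => y hy.
  rewrite -(subrKA y) addrC (le_trans (enormD _ _))// mulrDl lerD//.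
  apply: le_trans (return_close _) _; rewrite -[leRHS]mulrA ler_wpM2l//.
    by rewrite mulr_ge0// ltW.
  rewrite -(subrK (A j *m x) y) (le_trans (enormD _ _))// mulrDl lerD//.
  exact: A_bounded.
have st1 : sigma + 2 * theta < 1.
  apply: le_lt_trans q1; rewrite /q ler_peMr//.
  by case/andP: sigma01 => s0 _; rewrite addr_ge0// mulr_ge0.
have := @cyclic_linear_orbit_eq0 R k m Pu (fun j => A j) sigma theta
  Pu_le Ps_le sigma01 theta0 (fun j => A_comm (ltn_ord j))
  (fun j v => A_stable v (ltn_ord j)) (fun j v => A_unstable v (ltn_ord j))
  D (fun j => if j.+1 == m then s else 1) (fun j => v j) st1 DA.
move=> /(_ _ _ (Ordinal m_gt0)); apply.
  by move=> j; case: ifP => // _; rewrite Normc.normc1.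
move=> j; rewrite /D; have [jm|jm] := eqVneq j.+1 m.
  have vmE : v m = v j.+1 by rewrite jm.
  by rewrite /= jm modnn -vm vmE (vg _ (ltn_ord j)) !mulmxA.
rewrite scale1r -vg//= modn_small//.
by rewrite ltn_neqAle jm ltn_ord.
Qed.

End AlmostReturn.

(** * Closed orbits in the manifold *)

(** [eigenvalue] refers to row vectors, whereas derivatives act on columns. *)
Lemma eigenvalue_trmx (F : fieldType) (n : nat) (A : 'M[F]_n) (a : F) :
  eigenvalue A^T a = eigenvalue A a.
Proof.
rewrite !eigenvalue_root_char /char_poly -[X in root X a]det_tr; congr (root (\det _) a).
by rewrite /char_poly_mx linearB /= tr_scalar_mx map_trmx trmxK.
Qed.

Section OrbitInManifold.
Context {R : realType} {k : nat} {X : pmetricType R}.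
Local Notation Ck := 'cV[R[i]]_k.
Context {M : complex_manifold k X} {T : chart_family k X} {mu : probability (borel X) R}.
Hypothesis goodT : good_charts M T mu.
Variables (f : X -> X) (I : set X) (m : nat) (xs : nat -> X).
Variables (Cs : nat -> 'M[R[i]]_k) (g : nat -> Ck -> Ck) (r : nat -> R).
Hypothesis conj : forall n w, (n < m)%N -> enorm w <= r n ->
  [/\ ~ I (tau T (xs n) (Cs n *m w)), enorm (Cs n *m w) < tradius T,
      enorm (Cs n.+1 *m g n w) < tradius T &
      f (tau T (xs n) (Cs n *m w)) = tau T (xs n.+1) (Cs n.+1 *m g n w)].

Fixpoint iter_maps (n : nat) (w : Ck) : Ck :=
  if n is n'.+1 then g n' (iter_maps n' w) else w.

Lemma iter_conj n w : (n <= m)%N ->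
  (forall i, (i < n)%N -> enorm (iter_maps i w) <= r i) ->
  iter n f (tau T (xs 0) (Cs 0 *m w)) = tau T (xs n) (Cs n *m iter_maps n w).
Proof.
elim: n => [//|n ih] nm h; rewrite iterS ih ?(ltnW nm)//.
  by have [_ _ _ ->] := conj nm (h n (ltnSn n)).
by move=> i ni; apply: h; rewrite ltnS ltnW.
Qed.

Hypothesis same_chart : tidx T (xs m) = tidx T (xs 0).
Hypothesis C0_unit : Cs 0 \in unitmx.
Variable w0 : Ck.
Hypothesis m_gt0 : (0 < m)%N.
Hypothesis w0_in : forall n, (n < m)%N -> enorm (iter_maps n w0) < r n.
Hypothesis w0_return :
  w0 = return_map (Cs 0) (Cs m) (tbase T (xs m) - tbase T (xs 0)) (iter_maps m w0).

Let z := tau T (xs 0) (Cs 0 *m w0).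

Lemma orbit_at_m n : (n <= m)%N ->
  iter n f z = tau T (xs n) (Cs n *m iter_maps n w0).
Proof.
by move=> nm; apply: iter_conj => // i im; rewrite ltW// w0_in// (leq_trans im).
Qed.

Let C0w0 : tbase T (xs 0) + Cs 0 *m w0 = tbase T (xs m) + Cs m *m iter_maps m w0.
Proof.
rewrite {1}w0_return /return_map mulKVmx//.
by rewrite addrA [_ + (_ - _)]addrC subrK.
Qed.

Let z_end : tau T (xs m) (Cs m *m iter_maps m w0) = z.
Proof. by rewrite /z /tau same_chart -C0w0. Qed.

Lemma orbit_periodic : periodic_point f I m z.
Proof.
split=> [i im|]; last by rewrite orbit_at_m.
rewrite orbit_at_m ?(ltnW im)//.
by have [] := conj im (ltW (w0_in im)).
Qed.

Let p := psi (tidx T (xs 0)).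

Variable L : nat -> 'M[R[i]]_k.
Hypothesis gL : forall n, (n < m)%N -> hasD (g n) (iter_maps n w0) (L n).

Fixpoint iter_jac (n : nat) : 'M[R[i]]_k :=
  if n is n'.+1 then L n' *m iter_jac n' else 1%:M.

Lemma hasD_iter_maps n : (n <= m)%N -> hasD (iter_maps n) w0 (iter_jac n).
Proof.
elim: n => [|n ih] nm.
  have -> : iter_maps 0 = (fun v => 0 + 1%:M *m v).
    by apply/funext => v; rewrite add0r mul1mx.
  exact: hasD_affine.
exact: hasD_comp (ih (ltnW nm)) (gL nm).
Qed.

(** The bounds [w0_in] are strict, so nearby points also remain in the domains at every step; only
    then can the conjugacy be differentiated. *)
Lemma iter_conj_near n : (n <= m)%N -> \forall w \near w0, forall i, (i < n)%N ->
  enorm (iter_maps i w) <= r i.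
Proof.
elim: n => [|n ih] nm; first by apply/nbhs_enorm; exists 1.
have /nbhs_enorm[e e0 he] := ih (ltnW nm).
have rn : 0 < r n - enorm (iter_maps n w0) by rewrite subr_gt0 w0_in.
have [B B0 hB] := enorm_mulmx_bound (iter_jac n).
have [e' e'0 he'] := hasD_lipschitz ltr01 (hasD_iter_maps (ltnW nm)) hB.
have B1 : 0 < B + 1 by rewrite addr_gt0.
apply/nbhs_enorm; exists (Num.min (Num.min e e') ((r n - enorm (iter_maps n w0)) / (B + 1))).
  by rewrite !lt_min e0 e'0 divr_gt0.
move=> w; rewrite !lt_min => /andP[/andP[/he hw /he' hw']].
rewrite ltr_pdivlMr// mulrC => hr i; rewrite ltnS leq_eqVlt => /predU1P[->|/hw//].
rewrite -(subrK (iter_maps n w0) (iter_maps n w)) (le_trans (enormD _ _))//.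
by rewrite -lerBrDr (le_trans hw')// ltW.
Qed.

Variables (c : chart k X) (u : Ck).
Hypotheses (c_atlas : atlas M c) (cu : cdom c u) (pu : par c u = z).

(** [Theta] leads from the chart [c] to the Pesin chart at the start, [Psi] from the Pesin chart at
    the end back to [c]. Locally [f^m] reads as [Psi] after [iter_maps m] after [Theta], while
    [Theta] after [Psi] is [return_map]. *)
Let Theta (v : Ck) : Ck := invmx (Cs 0) *m (Defs.coord p (par c v) - tbase T (xs 0)).
Let Psi (w : Ck) : Ck := Defs.coord c (par p (tbase T (xs m) + Cs m *m w)).

Let w0T : enorm (Cs 0 *m w0) < tradius T.
Proof. by have [] := conj m_gt0 (ltW (w0_in m_gt0)). Qed.

Let cd0 : cdom p (tbase T (xs 0) + Cs 0 *m w0).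
Proof. exact: (tau_domain goodT (xs 0) w0T). Qed.

Let cdm : cdom p (tbase T (xs m) + Cs m *m iter_maps m w0).
Proof. by rewrite -C0w0. Qed.

Let p_holo : holomorphic_chart M p.
Proof. exact: psi_holomorphic goodT _. Qed.

Let zp : par p (tbase T (xs 0) + Cs 0 *m w0) = par c u.
Proof. by rewrite pu. Qed.

Let par_near (d : chart k X) (v : Ck) (A : set X) : is_chart d -> cdom d v ->
  nbhs (par d v) A -> \forall v' \near v, A (par d v').
Proof. by move=> [_ _ _ cont _] dv nA; exact: (cont v dv A nA). Qed.

Let par_coord (d : chart k X) x : is_chart d -> cimg d x -> par d (Defs.coord d x) = x.
Proof. by move=> [_ _ cK _ _] [v dv <-]; rewrite cK. Qed.

Let Theta_hasD : exists DT, hasD Theta u DT.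
Proof.
have [pc /(_ _ c_atlas)[_ comp]] := p_holo.
have pimg : cimg p (par c u) by rewrite -zp; exists (tbase T (xs 0) + Cs 0 *m w0).
have dTh := differentiable_hasD (comp u cu pimg).
pose aff (v : Ck) := invmx (Cs 0) *m (- tbase T (xs 0)) + invmx (Cs 0) *m v.
have := hasD_comp dTh (@hasD_affine R k (invmx (Cs 0) *m (- tbase T (xs 0)))
  (invmx (Cs 0)) _).
have -> : (fun v : Ck => invmx (Cs 0) *m (- tbase T (xs 0)) + invmx (Cs 0) *m v)
    \o (Defs.coord p \o par c) = Theta.
  by apply/funext => v; rewrite /= /Theta mulmxDr addrC.
by move=> h; eexists; exact: h.
Qed.

Let Psi_hasD : exists DP, hasD Psi (iter_maps m w0) DP.
Proof.
have [pc /(_ _ c_atlas)[comp _]] := p_holo.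
have cimgz : cimg c (par p (tbase T (xs m) + Cs m *m iter_maps m w0)).
  by rewrite -C0w0 zp; exists u.
have dPs := differentiable_hasD (comp _ cdm cimgz).
have := hasD_comp (@hasD_affine R k (tbase T (xs m)) (Cs m) (iter_maps m w0)) dPs.
by move=> h; eexists; exact: h.
Qed.

Let Theta_u : Theta u = w0.
Proof.
have [[_ _ cK _ _] _] := p_holo.
by rewrite /Theta -zp cK// addrC addKr mulKmx.
Qed.

Let Psi_m : Psi (iter_maps m w0) = u.
Proof.
have [_ _ cK _ _] := atlas_chart c_atlas.
by rewrite /Psi -C0w0 zp cK.
Qed.

Let Theta_Psi : \forall w \near iter_maps m w0,
  Theta (Psi w) = return_map (Cs 0) (Cs m) (tbase T (xs m) - tbase T (xs 0)) w.
Proof.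
have cc := atlas_chart c_atlas; have [pc _] := p_holo.
have [op oimg pK _ _] := pc; have [_ oc _ _ _] := cc.
have n1 : nbhs (par p (tbase T (xs m) + Cs m *m iter_maps m w0)) (cimg c).
  apply: open_nbhs_nbhs; split => //; rewrite -C0w0 zp; by exists u.
have n2 : nbhs (tbase T (xs m) + Cs m *m iter_maps m w0)
    [set v | cdom p v /\ cimg c (par p v)].
  apply: filterI; first exact: open_nbhs_nbhs.
  exact: par_near pc cdm n1.
have TP w : cdom p (tbase T (xs m) + Cs m *m w) ->
    cimg c (par p (tbase T (xs m) + Cs m *m w)) ->
    Theta (Psi w) = return_map (Cs 0) (Cs m) (tbase T (xs m) - tbase T (xs 0)) w.
  move=> pw cw; rewrite /Theta /Psi (par_coord cc cw) (pK _ pw) /return_map.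
  by rewrite addrAC.
have := hasD_continuous (@hasD_affine R k (tbase T (xs m)) (Cs m) (iter_maps m w0)).
move=> /(_ _ n2) n3.
have [e e0 he] := (nbhs_enorm _ _).1 n3.
apply/nbhs_enorm; exists e => [//|w ew].
by have [pw cw] := he w ew; exact: TP.
Qed.

Let conj_near : \forall v \near u,
  (Defs.coord c \o iter m f \o par c) v = (Psi \o (iter_maps m \o Theta)) v.
Proof.
have cc := atlas_chart c_atlas; have [pc _] := p_holo.
have [op oimg pK _ _] := pc.
have n1 : nbhs (par c u) (cimg p).
  by apply: open_nbhs_nbhs; split => //; rewrite -zp; exists (tbase T (xs 0) + Cs 0 *m w0).
have h1 := par_near cc cu n1.
have [DT hDT] := Theta_hasD.
have h2 : nbhs (Theta u) [set w | forall i, (i < m)%N -> enorm (iter_maps i w) <= r i].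
  by rewrite Theta_u; exact: iter_conj_near.
have /nbhs_enorm[e2 e20 he2] := hasD_continuous hDT h2.
have /nbhs_enorm[e1 e10 he1] := h1.
apply/nbhs_enorm; exists (Num.min e1 e2); first by rewrite lt_min e10.
move=> v; rewrite lt_min => /andP[/he1 pv /he2/= rv] /=.
have -> : par c v = tau T (xs 0) (Cs 0 *m Theta v).
  rewrite /tau /Theta mulKVmx// [_ + (_ - _)]addrC subrK -/p par_coord//.
by rewrite iter_conj// /Psi /tau same_chart.
Qed.

(** In the chart the derivative is [DP J DT], and [DT DP = C0^-1 Cm]. For an eigenvector [xi] the
    vectors [J_n DT xi] thus close up to the factor [s]; if [DT xi = 0], then [s xi = 0]. *)
Lemma orbit_derivative_eigenvector (s : R[i]) :
  eigenvalue (jac (Defs.coord c \o iter m f \o par c) u) s ->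
  exists v : nat -> Ck, [/\ (forall n, v n.+1 = L n *m v n),
    invmx (Cs 0) *m (Cs m *m v m) = s *: v 0%N & v 0%N = 0 -> s = 0].
Proof.
have [DT hDT] := Theta_hasD; have [DP hDP] := Psi_hasD.
have hG : hasD (iter_maps m) (Theta u) (iter_jac m).
  by rewrite Theta_u; exact: hasD_iter_maps.
have hP' : hasD Psi ((iter_maps m \o Theta) u) DP by rewrite /= Theta_u.
have hQ := hasD_near (hasD_comp (hasD_comp hDT hG) hP') conj_near.
have [_ ->] := hasD_diff hQ.
have hT' : hasD Theta (Psi (iter_maps m w0)) DT by rewrite Psi_m.
have TP : DT *m DP = invmx (Cs 0) *m Cs m.
  have h1 := hasD_comp hDP hT'.
  apply: hasD_unique h1 _.
  apply: (@hasD_near _ _ (fun w => invmx (Cs 0) *m (tbase T (xs m) - tbase T (xs 0))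
    + (invmx (Cs 0) *m Cs m) *m w)); first exact: hasD_affine.
  have /nbhs_enorm[e e0 he] := Theta_Psi.
  apply/nbhs_enorm; exists e => // w /he wE; rewrite [LHS]wE.
  by rewrite /return_map mulmxDr mulmxA.
rewrite -eigenvalue_trmx => /eigenvalueP[xi0 xiE xi_neq].
pose xi : Ck := xi0^T.
have {}xiE : DP *m (iter_jac m *m (DT *m xi)) = s *: xi.
  have := congr1 trmx xiE; rewrite trmx_mul trmxK linearZ /=.
  by move=> xiE'; rewrite -[RHS]xiE' !mulmxA.
exists (fun n => iter_jac n *m (DT *m xi)); split.
- by move=> n /=; rewrite !mulmxA.
- rewrite /= mul1mx (mulmxA (invmx (Cs 0)) (Cs m)) -TP -(mulmxA DT DP) xiE.
  by rewrite -scalemxAr.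
move=> /=; rewrite mul1mx => v0; move: xiE; rewrite v0 !mulmx0 => /esym/eqP.
rewrite scaler_eq0 => /orP[/eqP//|/eqP xi00].
by move: xi_neq; rewrite -[xi0]trmxK -/xi xi00 trmx0 eqxx.
Qed.

End OrbitInManifold.

(** * The closing lemma *)

Lemma finite_positive_lower_bound {R : realType} {k : nat} (v : 'I_k -> R) :
  (forall a, 0 < v a) -> exists2 e, 0 < e & forall a, e <= v a.
Proof.
move=> v0; have S0 b : 0 <= \sum_(a < k | a != b) (v a)^-1.
  by apply: sumr_ge0 => a _; rewrite invr_ge0 ltW.
have S1 : 0 < 1 + \sum_(a < k) (v a)^-1.
  by rewrite ltr_pwDl// sumr_ge0// => a _; rewrite invr_ge0 ltW.
exists (1 + \sum_(a < k) (v a)^-1)^-1; first by rewrite invr_gt0.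
move=> a; rewrite -[leRHS]invrK lef_pV2 ?posrE ?invr_gt0// (bigD1 a)//=.
by rewrite addrCA lerDl addr_ge0.
Qed.

Lemma slowly_varying_le {R : realType} (gamma : R) (a : nat -> R) :
  (forall n, 0 < a n) ->
  (forall n, expR (- gamma) <= a n.+1 / a n <= expR gamma) ->
  forall n d, a (n + d)%N <= a n * expR (gamma * d%:R) /\
              a n <= a (n + d)%N * expR (gamma * d%:R).
Proof.
move=> a0 h n; elim=> [|d [ih1 ih2]]; first by rewrite addn0 mulr0 expR0 mulr1.
have E : expR (gamma * d.+1%:R) = expR (gamma * d%:R) * expR gamma.
  by rewrite -expRD -natr1 mulrDr mulr1.
have /andP[lo up] := h (n + d)%N; rewrite addnS E; split.
  move: up; rewrite ler_pdivrMr// => /le_trans; apply.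
  by rewrite mulrA mulrC ler_wpM2r ?expR_ge0.
move: lo; rewrite expRN ler_pdivlMr// mulrC ler_pdivrMr ?expR_gt0// => lo.
apply: le_trans ih2 _; rewrite [_ * expR gamma]mulrC mulrA.
by rewrite ler_wpM2r ?expR_ge0.
Qed.

(** Controls the distortion of a Pesin chart by its own radius: [C] maps the ball of radius
    [1 / a_n] into that of radius [tradius T], so it expands by at most [tradius T * a_n]. *)
Lemma enorm_mulmx_ball {R : realType} {k : nat} (A : 'M[R[i]]_k) (r s : R)
    (v : 'cV[R[i]]_k) : 0 < r ->
  (forall w, enorm w <= r -> enorm (A *m w) < s) ->
  enorm (A *m v) <= s / r * enorm v.
Proof.
move=> r0 h; have [->|v0] := eqVneq v 0; first by rewrite mulmx0 enorm0 mulr0.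
have V : 0 < enorm v.
  by rewrite lt_def enorm_ge0 andbT; apply: contra v0 => /eqP/enorm0_eq0->.
have rv : 0 < r / enorm v by rewrite divr_gt0.
have := h ((r / enorm v)%:C *: v); rewrite enormZr (gtr0_norm rv) divfK ?gt_eqF//.
move=> /(_ (lexx _)); rewrite -scalemxAr enormZr (gtr0_norm rv) => /ltW.
rewrite -ler_pdivlMl// invf_div => /le_trans; apply.
by rewrite mulrC mulrA mulrAC.
Qed.

Theorem mainTheorem2 (R : realType) (k m0 : nat) (chi : 'I_k -> \bar R)
  (m0_gt0 : (1 <= m0)%N) (m0_lt : (m0 <= k - 1)%N)
  (chi_noninc : forall a b : 'I_k, (a <= b)%N -> (chi b <= chi a)%E)
  (chi_lty : forall a, (chi a < +oo)%E)
  (chi_pos : forall a : 'I_k, (a < m0)%N -> (0 < chi a)%E)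
  (chi_neg : forall a : 'I_k, (m0 <= a)%N -> (chi a < 0)%E) :
  exists2 gamma0 : R, 0 < gamma0 &
  forall gamma : R, 0 < gamma < gamma0 ->
  (forall a b : 'I_k, a.+1 = m0 -> b = m0 :> nat ->
    ((4 * gamma)%:E < chi a - chi b)%E) ->
  forall (X : pmetricType R) (M : complex_manifold k X)
    (f : X -> X) (I : set X) (mu : probability (borel X) R)
    (T : chart_family k X)
    (muhat : probability (borel {ptws int -> X}) R)
    (dhat : {ptws int -> X} -> {ptws int -> X} -> R)
    (l : nat) (lambda : 'I_l -> \bar R) (mult : 'I_l -> nat)
    (Gam Gam' : set {ptws int -> X})
    (E : 'I_l -> {ptws int -> X} -> {vspace 'cV[R[i]]_k})
    (C : {ptws int -> X} -> 'M[R[i]]_k) (eps1 K p : R)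
    (alphag : {ptws int -> X} -> R)
    (delta eps0 : R) (Lam : set {ptws int -> X}),
  compact [set: X] ->
  meromorphic M f I -> dominant f I ->
  invariant_ergodic f I mu ->
  natural_extension f I mu muhat -> standard_metric f I dhat ->
  good_charts M T mu ->
  exponents_with_multiplicity chi lambda mult ->
  oseledets f I T muhat lambda mult Gam E ->
  pesin_reduction f T chi lambda gamma C Gam E ->
  holomorphy_constants f I T C eps1 K p Gam ->
  tempered_majorant f I muhat gamma C eps1 K p Gam Gam' alphag ->
  0 < delta < 6^-1 ->
  lusin_set T muhat C mu Gam' alphag delta eps0 Lam ->
  forall eps : R, 0 < eps ->
  exists2 eta : R, 0 < eta &
  forall (x : {ptws int -> X}) (m : nat), (1 <= m)%N ->
    Lam x -> Lam (shiftZ m%:Z x) -> dhat x (shiftZ m%:Z x) < eta ->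
    exists z : X,
      [/\ periodic_point f I m z,
          forall i : nat, (i <= m)%N ->
            mdist (iter i f (x 0)) (iter i f z) <=
            eps * Num.max (expR (- (gamma * i%:R)))
                          (expR (- (gamma * (m - i)%:R))) &
          hyperbolic_point M f m z].
Proof.
(* [fine] sends [-oo] to [0], hence the separate value [1]. The [5] is the rate [4] plus the loss of
   one [gamma] in the Pesin reduction. *)
pose v (a : 'I_k) : R := if chi a == -oo%E then 1 else `|fine (chi a)| / 5.
have chi_neq0 a : chi a != 0%E.
  have [/chi_pos h|/chi_neg h] := ltnP a m0; first by rewrite gt_eqF.
  by rewrite lt_eqF.
have v0 a : 0 < v a.
  rewrite /v; case: eqP => [//|/eqP ninf]; rewrite divr_gt0// normr_gt0.
  have := chi_neq0 a; rewrite -[chi a]fineK ?eqe//.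
  by rewrite fin_numE ninf lt_eqF.
have [gamma0 gamma00 hgamma0] := finite_positive_lower_bound v0.
exists gamma0 => // gamma /andP[gam0 gamlt] _.
have gamma_chi a : chi a != -oo%E -> 5 * gamma <= `|fine (chi a)|.
  move=> ninf; have := le_trans (ltW gamlt) (hgamma0 a).
  by rewrite /v (negbTE ninf) ler_pdivlMr// mulrC.
move=> X M f I mu T muhat dhat l lambda mult Gam Gam' E C eps1 K p alphag delta
  eps0 Lam cX mero _ _ _ sm goodT mults os pe holo tm _ lu eps eps_gt0.
have k_gt0 : (0 < k)%N by move: m0_gt0 m0_lt; case: (k) => // /leq_trans h /h.
have openI : open (~` I) := (mero_holo mero).1.
have [_ _ Gam_sub Gam_shift] := os_set os.
have [_ _ Gam'_sub Gam'_shift] := tm_set tm.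
have C_unit := pe_unit pe.
have Lam_sub x : Lam x -> Omega_hat f I x by move=> /(lu_sub lu)[/Gam'_sub].
have alphag_gt0 y : Gam' y -> 0 < alphag y.
  move=> /(tm_ge tm); apply: lt_le_trans.
  by rewrite /Defs.alpha lt_max ltr01.
have [a0 a0_gt0 ha0] := within_inv_bounded (lu_compact lu)
  (fun y Ly => alphag_gt0 y (lu_sub lu Ly).1) (lu_r lu).
have [KT KT_gt0 hKT] := tau_lipschitz goodT cX.
have [c0 c0_gt0 hc0] := within_matrix_bounded (lu_compact lu) (lu_Cinv lu).
pose Abar := 1 + \sum_(a < k) expR (fine (chi a) + gamma).
have Abar_gt0 : 0 < Abar.
  by rewrite ltr_pwDl// sumr_ge0// => a _; exact: expR_ge0.
pose sigma := expR (- (4 * gamma)); pose tau2 := expR (2 * gamma).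
have tau2_gt0 : 0 < tau2 by exact: expR_gt0.
have d_gt0 : 0 < tau2^-1 - sigma.
  by rewrite subr_gt0 -expRN ltr_expR; lra.
(* Below, [theta = 2 * theta1], so [2 * theta] uses at most half of the gap between [sigma] and
   [tau2^-1], whence [q < 1]. *)
pose theta1 := Num.min 1 ((tau2^-1 - sigma) / 4) / 2.
have th0 : 0 < theta1 by rewrite divr_gt0// lt_min ltr01 divr_gt0.
have th1 : theta1 < 1.
  have : Num.min 1 ((tau2^-1 - sigma) / 4) <= 1 by rewrite ge_min lexx.
  by rewrite /theta1; lra.
have th2 : 4 * theta1 <= (tau2^-1 - sigma) / 2.
  have : Num.min 1 ((tau2^-1 - sigma) / 4) <= (tau2^-1 - sigma) / 4.
    by rewrite ge_min lexx orbT.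
  by rewrite /theta1; lra.
(* Makes the seam contribute exactly as much as the nonlinear remainder. *)
pose kappa := theta1 / (c0 * (theta1 + Abar)).
have tA : 0 < theta1 + Abar by rewrite addr_gt0.
have kappa_gt0 : 0 < kappa by rewrite divr_gt0// mulr_gt0.
have thetaE : c0 * kappa * (theta1 + Abar) = theta1.
  by rewrite /kappa; field; rewrite !gt_eqF.
pose q := (sigma + 2 * (theta1 + c0 * kappa * (theta1 + Abar))) * tau2.
have q1 : q < 1.
  rewrite /q thetaE -ltr_pdivlMr// div1r; lra.
have RT := tau_radius goodT.
have K4 : 0 < 4 * KT * tradius T * a0 by do !apply: mulr_gt0 => //.
have a2 : 0 < 2 * a0 by exact: mulr_gt0.
(* The first entry bounds the nonlinearity, the second the final distance; its [4] is the [2] of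
   [2 * rho] times the [2] of [eps / 2]. *)
pose c := Num.min (theta1 / (2 * a0)) (eps / (4 * KT * tradius T * a0)).
have c_gt0 : 0 < c.
  by rewrite lt_min; apply/andP; split; apply: divr_gt0.
have c_small : 2 * (c * a0) <= theta1.
  have : c <= theta1 / (2 * a0) by rewrite ge_min lexx.
  by rewrite ler_pdivlMr// mulrCA.
have c_eps : 4 * KT * tradius T * a0 * c <= eps.
  have : c <= eps / (4 * KT * tradius T * a0) by rewrite ge_min lexx orbT.
  by rewrite ler_pdivlMr// mulrC.
pose beta := (1 - q) * c / c0.
have beta_gt0 : 0 < beta by rewrite divr_gt0// mulr_gt0// subr_gt0.
have b_small : c0 * beta <= (1 - q) * c.
  by rewrite /beta mulrC divfK// gt_eqF.
have same y z : Lam y -> Lam z -> mdist (y 0) (z 0) < eps0 ->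
    tidx T (y 0) = tidx T (z 0).
  by move=> /(lu_sub lu)[_ h1] /(lu_sub lu)[_ h2]; exact: (lu_same_chart lu).
have [e1 e1_gt0 he1] := within_matrix_uniform sm (lu_compact lu) Lam_sub
  kappa_gt0 (lu_C lu).
have [e2 e2_gt0 he2] := tbase_uniform sm (lu_compact lu) Lam_sub goodT
  (lu_eps0 lu) beta_gt0 same.
(* [e1] makes the matrices [C] close, [e2] the base points, and [eps0] forces a common chart. The
   entry [eps / 2] is for time [m], when the end point is compared with [z] through [x]. *)
exists (Num.min (Num.min e1 e2) (Num.min eps0 (eps / 2))).
  by rewrite !lt_min e1_gt0 e2_gt0 (lu_eps0 lu) divr_gt0.
move=> x m m_gt0 Lx Lm; rewrite !lt_min => /andP[/andP[xe1 xe2] /andP[xe0 xeps]].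
pose y (n : nat) := shiftZ n%:Z x.
have y0 : y 0%N = x by exact: shiftZ0.
have Gy' n : Gam' (y n) by apply: shiftZ_invariant => //; exact: (lu_sub lu Lx).1.
have Gy n : Gam (y n) by exact: (tm_sub tm).
have yS n : shiftZ 1 (y n) = y n.+1 by exact: shiftZS.
pose xs n : X := y n 0; pose Cs n := C (y n); pose g n := gloc f T C (y n).
pose a n := alphag (y n); pose A n := Agamma f T C (y n).
have a_gt0 n : 0 < a n by exact: alphag_gt0.
have alpha_a n : Defs.alpha I C eps1 K p (y n) <= a n by exact: (tm_ge tm).
have slow := slowly_varying_le a_gt0
  (fun n => eq_ind _ (fun t => expR (- gamma) <= alphag t / a n <= expR gamma)
     (tm_ratio tm (Gy' n)) _ (yS n)).
have a_up n : (n < m)%N -> a n <= a0 * expR (gamma * n%:R).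
  move=> nm; have [h _] := slow 0%N n; apply: le_trans h _.
  by rewrite ler_wpM2r ?expR_ge0// /a y0 ha0.
(* The end point lies in [Lam] too, so slow variation can be used backwards from time [m]. *)
have a_down n : (n < m)%N -> a n <= a0 * expR (gamma * (m - n)%:R).
  move=> nm; have [_ h] := slow n (m - n)%N; apply: le_trans h _.
  by rewrite ler_wpM2r ?expR_ge0// subnKC ?(ltnW nm)// /a ha0.
have conj n w : (n < m)%N -> enorm w <= (a n)^-1 ->
  [/\ ~ I (tau T (xs n) (Cs n *m w)), enorm (Cs n *m w) < tradius T,
      enorm (Cs n.+1 *m g n w) < tradius T &
      f (tau T (xs n) (Cs n *m w)) = tau T (xs n.+1) (Cs n.+1 *m g n w)].
  move=> _ /(gloc_conj k_gt0 openI goodT holo Gam_sub Gam_shift C_unit (Gy n) (alpha_a n)).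
  by rewrite yS.
have gD2 n w (_ : (n < m)%N) (wr : enorm w <= (a n)^-1) :=
  gloc_D2 k_gt0 openI holo Gam_sub C_unit (Gy n) (alpha_a n) wr.
have gjac n (_ : (n < m)%N) :=
  jac_gloc0 k_gt0 openI holo Gam_sub Gam_shift C_unit (Gy n) (alpha_a n).
have g0 n (_ : (n < m)%N) : g n 0 = 0 := gloc0 C goodT (y n).
pose Pu : 'M[R[i]]_k := proj_mx_on (fun a : 'I_k => (0 < chi a)%E).
have Adiag n a' b' : chi a' != chi b' -> A n a' b' = 0.
  by move=> h; exact: (pe_diag pe (Gy n) h).
have Afin n i w (li : lambda i != -oo%E) (bw : in_block chi lambda i w) :=
  pe_finite pe (Gy n) li bw.
have Ainf n i w (li : lambda i = -oo%E) (bw : in_block chi lambda i w) :=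
  pe_infinite pe (Gy n) li bw.
have Acomm n (_ : (n < m)%N) : A n *m Pu = Pu *m A n := unstable_comm (Adiag n).
have Aunst n w (_ : (n < m)%N) :=
  unstable_expansion mults (Adiag n) chi_lty gamma_chi (Afin n) w.
have Ast n w (_ : (n < m)%N) := stable_contraction mults (Adiag n) chi_lty
  chi_neq0 gamma_chi (Afin n) (Ainf n) w.
have Abd n w (_ : (n < m)%N) : enorm (A n *m w) <= Abar * enorm w :=
  block_bounded mults (Adiag n) gam0 (Afin n) (Ainf n) w.
have C0u : Cs 0%N \in unitmx by exact: C_unit.
have C0inv w : enorm (invmx (Cs 0%N) *m w) <= c0 * enorm w.
  by rewrite /Cs y0; exact: hc0 Lx w.
have Cclose w : enorm (Cs m *m w - Cs 0%N *m w) <= kappa * enorm w.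
  by rewrite /Cs y0; exact: he1 Lx Lm xe1 w.
have ble : enorm (tbase T (xs m) - tbase T (xs 0%N)) <= beta.
  by rewrite /xs y0; exact: he2 Lx Lm xe2.
have mxm := le_lt_trans (dhat_proj sm (Lam_sub _ Lx) (Lam_sub _ Lm)).
have same0 : tidx T (xs m) = tidx T (xs 0%N).
  by rewrite /xs y0; apply/esym/same => //; exact: mxm xe0.
have [W [Wr WS W0]] := closing_orbit m_gt0 gam0 c_gt0 a0_gt0 c0_gt0
  (ltW kappa_gt0) (ltW Abar_gt0) (ltW th0) th1 q1 c_small b_small
  (proj_mx_on_idem _) (proj_mx_on_le _) (proj_mx_on_comp_le _) gD2 g0 gjac
  (fun n _ => a_gt0 n) a_up a_down Acomm Ast Aunst Abd C0u C0inv Cclose ble.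
have WE n : W n = iter_maps g n (W 0%N) by elim: n => //= n <-; exact: WS.
have W_lt n : (n < m)%N -> enorm (iter_maps g n (W 0%N)) < (a n)^-1.
  move=> nm; rewrite -WE; apply: le_lt_trans (Wr n nm) _.
  exact: (weight_lt_radius gam0 c_gt0 a0_gt0 th1 c_small (fun n _ => a_gt0 n) a_up a_down).
have W0' : W 0%N = return_map (Cs 0%N) (Cs m) (tbase T (xs m) - tbase T (xs 0%N))
   (iter_maps g m (W 0%N)) by rewrite -WE.
have orb n : iter n f (x 0) = xs n.
  elim: n => [|n ih]; first by rewrite /xs y0.
  by rewrite iterS ih /xs (Omega_hat_step (Gam_sub _ (Gy n))) yS.
set z := tau T (xs 0%N) (Cs 0%N *m W 0%N).
have perz : periodic_point f I m z := orbit_periodic conj same0 C0u W_lt W0'.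
have dist_lt n : (n < m)%N -> mdist (iter n f (x 0)) (iter n f z) <= eps / 2 *
    Num.max (expR (- (gamma * n%:R))) (expR (- (gamma * (m - n)%:R))).
  move=> nm; rewrite orb (orbit_at_m conj W_lt (ltnW nm)) -WE.
  have WrT : enorm (W n) <= (a n)^-1 by rewrite WE ltW// W_lt.
  have [_ CT _ _] := conj n (W n) nm WrT.
  apply: le_trans (hKT _ _ CT) _.
  have Cn : enorm (Cs n *m W n) <= tradius T / (a n)^-1 * enorm (W n).
    apply: enorm_mulmx_ball; first by rewrite invr_gt0.
    by move=> w wr; have [_] := conj n w nm wr.
  rewrite invrK in Cn.
  have aw := shadow_weight_tempered c_gt0 (ltW a0_gt0) (a_up n nm) (a_down n nm).
  set mx := Num.max _ _ in aw *.
  have mx0 : 0 <= mx by rewrite le_max expR_ge0.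
  have Wn := Wr n nm; set rn := shadow_weight _ _ _ _ in aw Wn.
  apply: le_trans (ler_wpM2l (ltW KT_gt0) Cn) _.
  apply: (@le_trans _ _ (KT * (tradius T * a n * (2 * rn)))).
    rewrite ler_pM2l// ler_wpM2l// mulr_ge0// ltW//; exact: a_gt0.
  apply: (@le_trans _ _ (2 * KT * tradius T * (a0 * c * mx))).
    rewrite [leLHS](_ : _ = 2 * KT * tradius T * (a n * rn)); last by ring.
    by rewrite ler_wpM2l// !mulr_ge0// ltW.
  rewrite [leLHS](_ : _ = 4 * KT * tradius T * a0 * c / 2 * mx); last by field.
  by rewrite ler_wpM2r// ler_pM2r.
exists z; split=> //.
- move=> n; rewrite leq_eqVlt => /predU1P[->|nm]; last first.
    apply: le_trans (dist_lt n nm) _; apply: ler_wpM2r.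
      by rewrite le_max expR_ge0.
    by lra.
  have [_ ->] := perz; rewrite subnn mulr0 oppr0 expR0.
  apply: (@le_trans _ _ eps); last first.
    by rewrite ler_pMr// le_max lexx orbT.
  apply: le_trans (metric_triangle _ (x 0) _) _; rewrite [eps]splitr lerD//.
    rewrite orb metric_sym; apply: ltW; exact: mxm xeps.
  have := dist_lt 0%N m_gt0; rewrite /= => /le_trans; apply.
  have e1_le (t : R) : 0 <= t -> expR (- (gamma * t)) <= 1.
    by move=> t0; rewrite -[leRHS]expR0 ler_expR oppr_le0 mulr_ge0// ltW.
  have eps2 : 0 < eps / 2 by rewrite divr_gt0.
  by rewrite -[leRHS]mulr1 (ler_pM2l eps2) ge_max !e1_le.
move=> ch u ach cu pu s ev; apply/negP => /eqP s1.
have nrm_s : Normc.normc s = 1.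
  by apply: (@complexI R); rewrite -normcE s1.
have gL n (nm : (n < m)%N) : hasD (g n) (iter_maps g n (W 0%N)) (jac (g n) (W n)).
  rewrite -WE; apply: differentiable_hasD.
  by apply: (gD2 n (W n) nm _).1; rewrite WE ltW// W_lt.
have [w [wS wm w00]] := orbit_derivative_eigenvector goodT conj same0 C0u m_gt0
  W_lt W0' gL ach cu pu ev.
have := closing_orbit_hyperbolic m_gt0 gam0 c_gt0 a0_gt0 c0_gt0
  (ltW kappa_gt0) (ltW Abar_gt0) (ltW th0) th1 q1 c_small
  (proj_mx_on_le _) (proj_mx_on_comp_le _) gD2 gjac
  (fun n _ => a_gt0 n) a_up a_down Acomm Ast Aunst Abd C0u C0inv Cclose
  Wr (fun n _ => wS n) nrm_s wm.
move=> /w00 s0; move: nrm_s; rewrite s0 Normc.normc0 => /esym/eqP.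
by rewrite oner_eq0.
Qed.
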